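(* Let $\Delta=\rho^2$ with $\rho$ a positive integer. Let $t$ be the number of points of a chain inside $H^0$, with initial point $\mathbf f$ and final point $\mathbf g$. Let $T$ be the operator of $\mathcal T^+$ satisfying $T\mathbf f=\mathbf g$. Then $T$ is the product of $t-1$ generators. Among them, $t_A$ are of type $A$ and $t_B$ of type $B$ if and only if the orbit of $\mathbf f$ contains exactly $t_B$ points inside every domain in $G_A$ and $G_{\bar A}$, and exactly $t_A$ points inside every domain in $G_B$ and $G_{\bar B}$; so that $t_A+t_B=t-1$.
   Context: A form $f=mx^2+ny^2+kxy$ with integer coefficients is identified with $\mathbf f=(m,n,k)\in\mathbb Z^3$, called a good point; put $K=k$, $D=m-n$, $S=m+n$; the discriminant is $\Delta=k^2-4mn=K^2+D^2-S^2$ and $H=H_\Delta=\{K^2+D^2-S^2=\Delta\}\subset\mathbb R^3$. For $L\in\mathrm{SL}(2,\mathbb Z)$, $T_L$ sends $f$ to $f'$ with $f'(v)=f(Lv)$; $\mathcal T=\{T_L\}$; the orbit of $\mathbf f$ is $\{T\mathbf f:T\in\mathcal T\}$. $A(m,n,k)=(m,m+n+k,k+2m)$, $B(m,n,k)=(m+n+k,n,k+2n)$, $\bar A=A^{-1}$, $\bar B=B^{-1}$; $\mathcal T^+$ is the semigroup generated by the identity, $A$ and $B$ (the generators are $A$ and $B$). Subsets of $H$: $H^0=\{|S|<|D|,D>0\}$, $H^0_R=\{|S|<|D|,D<0\}$; $G_A=\{S>|D|,K>0\}$, $G_{\bar A}=\{S>|D|,K<0\}$, $G_B=\{S<-|D|,K<0\}$,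 $G_{\bar B}=\{S<-|D|,K>0\}$. Open segments (in coordinates $(K,D,S)$): $F_A=\{(\rho,r,r):0<r<\rho\}$, $F_{\bar A}=\{(-\rho,r,r):0<r<\rho\}$, $F_{\bar B}=\{(\rho,r,-r):0<r<\rho\}$, $F_B=\{(-\rho,r,-r):0<r<\rho\}$. Chain: a finite sequence of good points $\mathbf f_1,\dots,\mathbf f_t$ inside $H^0$, each obtained from the preceding one by $A$ or by $B$, such that the initial point $\mathbf f_1$ satisfies $\bar A\mathbf f_1\in F_{\bar A}$, $\bar B\mathbf f_1\in F_{\bar B}$, and the final point $\mathbf f_t$ satisfies $A\mathbf f_t\in F_A$, $B\mathbf f_t\in F_B$. Domains: rational numbers have generations: $0/1$ and $1/0$ have generation zero; for $n\ge1$ the positive rationals of generation $n$ are obtained from $1/1$ by applying all words of length $n-1$ in $x\mapsto x+1$ and $x\mapsto x/(x+1)$; a negative rational has the generation of its absolute value. For $x=p/q$ in lowest terms the rhombus $H^{x}$ is $\{(K,D,S)\in H:(p^2+q^2)|S|<2pqK+(q^2-p^2)D\}$ (a rotation of $H^0$ about the $S$-axis). $H^{\mathbf n}$ is the union of the rhombi of generation $n$; $\mathcal H^{\mathbf 0}=H^0\cup H^0_R$ and, for $n\ge1$, $\mathcal H^{\mathbf n}=H^{\mathbf n}\setminus(\overline{H^{\mathbf 0}}\cup\dots\cup\overline{H^{\mathbf{n-1}}})$, closures in $H$. ''A domain in $G_A$'' (resp. $G_{\bar A},G_B,G_{\bar B}$) means a connected component, contained in $G_A$ (resp. $G_{\bar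 A},G_B,G_{\bar B}$), of some $\mathcal H^{\mathbf r}$ with $r\ge1$. *)

(* Defs.v *)
From mathcomp Require Import all_boot all_order all_algebra.
From mathcomp Require Import all_classical all_reals all_analysis.
From mathcomp Require Import ring.
Set Implicit Arguments.
Unset Strict Implicit.
Unset Printing Implicit Defensive.
Import Order.TTheory GRing.Theory Num.Theory.
Import numFieldNormedType.Exports.
Local Open Scope classical_set_scope.
Local Open Scope ring_scope.

(** * Good points and operators *)

(* The triple (m, n, k) stands for the form m x^2 + n y^2 + k x y. *)
Definition good_point : Type := (int * int * int)%type.

Definition form_eval (f : good_point) (v : 'cV[int]_2) : int :=
  let: (m, n, k) := f in
  m * v 0 0 ^+ 2 + n * v 1 0 ^+ 2 + k * v 0 0 * v 1 0.

(* The operator T_L : f |-> f o L, see form_actE. *)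
Definition form_act (L : 'M[int]_2) (f : good_point) : good_point :=
  let: (m, n, k) := f in
  (form_eval f (col 0 L), form_eval f (col 1 L),
   2 * m * L 0 0 * L 0 1 + 2 * n * L 1 0 * L 1 1
   + k * (L 0 0 * L 1 1 + L 0 1 * L 1 0)).

Lemma form_actE (L : 'M[int]_2) (f : good_point) (v : 'cV[int]_2) :
  form_eval (form_act L f) v = form_eval f (L *m v).
Proof.
case: f => [[m n] k]; rewrite /form_act /form_eval !mxE.
rewrite !big_ord_recl !big_ord0 /= !addr0.
have -> : lift ord0 ord0 = 1 :> 'I_2 by apply/val_inj.
have -> : ord0 = 0 :> 'I_2 by apply/val_inj.
ring.
Qed.

Definition calT : set (good_point -> good_point) :=
  [set form_act L | L in [set L : 'M[int]_2 | \det L = 1]].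

Definition orbit_of (f : good_point) : set good_point :=
  [set T f | T in calT].

Definition opA (f : good_point) : good_point :=
  let: (m, n, k) := f in (m, m + n + k, k + 2 * m).
Definition opB (f : good_point) : good_point :=
  let: (m, n, k) := f in (m + n + k, n, k + 2 * n).
Definition opAbar (f : good_point) : good_point :=
  let: (m, n, k) := f in (m, m + n - k, k - 2 * m).
Definition opBbar (f : good_point) : good_point :=
  let: (m, n, k) := f in (m + n - k, n, k - 2 * n).

Lemma opAK : cancel opA opAbar.
Proof. by case=> [[m n] k]; congr (_, _, _); ring. Qed.
Lemma opAbarK : cancel opAbar opA.
Proof. by case=> [[m n] k]; congr (_, _, _); ring. Qed.
Lemma opBK : cancel opB opBbar.
Proof. by case=> [[m n] k]; congr (_, _, _); ring. Qed.
Lemma opBbarK : cancel opBbar opB.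
Proof. by case=> [[m n] k]; congr (_, _, _); ring. Qed.

Inductive calTplus : (good_point -> good_point) -> Prop :=
| calTplus_id : calTplus id
| calTplus_A : calTplus opA
| calTplus_B : calTplus opB
| calTplus_comp T U : calTplus T -> calTplus U -> calTplus (T \o U).

Inductive generator : Type := GenA | GenB.

Definition gen_op (x : generator) : good_point -> good_point :=
  match x with GenA => opA | GenB => opB end.
Definition is_A (x : generator) : bool := if x is GenA then true else false.
Definition is_B (x : generator) : bool := if x is GenB then true else false.

Definition gen_prod (w : seq generator) : good_point -> good_point :=
  foldr (fun x T => gen_op x \o T) id w.

(** * Regions of the hyperboloid *)

Section Regions.
Variable R : realType.
Implicit Types (P : R * R * R) (Delta rho : R).

Definition coordK P : R := P.1.1.
Definition coordD P : R := P.1.2.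
Definition coordS P : R := P.2.

Definition KDS (f : good_point) : R * R * R :=
  let: (m, n, k) := f in (k%:~R, (m - n)%:~R, (m + n)%:~R).

Definition hyperboloid Delta : set (R * R * R) :=
  [set P | coordK P ^+ 2 + coordD P ^+ 2 - coordS P ^+ 2 = Delta].

Definition H0 Delta : set (R * R * R) :=
  [set P | hyperboloid Delta P /\ `|coordS P| < `|coordD P| /\ 0 < coordD P].
Definition H0R Delta : set (R * R * R) :=
  [set P | hyperboloid Delta P /\ `|coordS P| < `|coordD P| /\ coordD P < 0].

Definition GA Delta : set (R * R * R) :=
  [set P | hyperboloid Delta P /\ `|coordD P| < coordS P /\ 0 < coordK P].
Definition GAbar Delta : set (R * R * R) :=
  [set P | hyperboloid Delta P /\ `|coordD P| < coordS P /\ coordK P < 0].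
Definition GB Delta : set (R * R * R) :=
  [set P | hyperboloid Delta P /\ coordS P < - `|coordD P| /\ coordK P < 0].
Definition GBbar Delta : set (R * R * R) :=
  [set P | hyperboloid Delta P /\ coordS P < - `|coordD P| /\ 0 < coordK P].

Definition FA rho : set (R * R * R) :=
  [set (rho, r, r) | r in [set r : R | 0 < r < rho]].
Definition FAbar rho : set (R * R * R) :=
  [set (- rho, r, r) | r in [set r : R | 0 < r < rho]].
Definition FBbar rho : set (R * R * R) :=
  [set (rho, r, - r) | r in [set r : R | 0 < r < rho]].
Definition FB rho : set (R * R * R) :=
  [set (- rho, r, - r) | r in [set r : R | 0 < r < rho]].

(* The chain f :: s, with initial point f and final point last f s. *)
Definition is_chain rho (f : good_point) (s : seq good_point) : Prop :=
  [/\ (forall h, h \in f :: s -> H0 (rho ^+ 2) (KDS h)),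
      path (fun h h' => (h' == opA h) || (h' == opB h)) f s,
      FAbar rho (KDS (opAbar f)) /\ FBbar rho (KDS (opBbar f)) &
      FA rho (KDS (opA (last f s))) /\ FB rho (KDS (opB (last f s)))].

(** * Domains *)

Definition gen_step (b : bool) (x : rat) : rat :=
  if b then x + 1 else x / (x + 1).

(* The fractions p/q, as pairs (p, q) in lowest terms, of generation n;
   pairs are needed because 1/0 is one of them. *)
Definition generation (n : nat) : set (int * int) :=
  match n with
  | 0%N => [set (0, 1); (1, 0)]
  | n'.+1 => [set (numq x, denq x) | x in
      [set x : rat | exists w : seq bool,
                       size w = n' /\ `|x| = foldr gen_step 1 w]]
  end.

Definition rhombus Delta (x : int * int) : set (R * R * R) :=
  let p : R := x.1%:~R in let q : R := x.2%:~R in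
  [set P | hyperboloid Delta P /\
     (p ^+ 2 + q ^+ 2) * `|coordS P|
       < 2 * p * q * coordK P + (q ^+ 2 - p ^+ 2) * coordD P].

Definition Hgen Delta (n : nat) : set (R * R * R) :=
  \bigcup_(x in generation n) rhombus Delta x.

Definition closure_in_H Delta (X : set (R * R * R)) : set (R * R * R) :=
  closure X `&` hyperboloid Delta.

Definition calH Delta (n : nat) : set (R * R * R) :=
  match n with
  | 0%N => H0 Delta `|` H0R Delta
  | _.+1 => Hgen Delta n
              `\` \bigcup_(i in `I_n) closure_in_H Delta (Hgen Delta i)
  end.

Definition domain_in Delta (G D : set (R * R * R)) : Prop :=
  D `<=` G /\
  exists2 r : nat, (1 <= r)%N &
    exists2 P, calH Delta r P & D = connected_component (calH Delta r) P.

Definition orbit_count_in_domains Delta (f : good_point) (G : set (R * R * R))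
    (n : nat) : Prop :=
  forall D, domain_in Delta G D ->
    ([set h | orbit_of f h /\ D (KDS h)] #= `I_n)%card.

End Regions.

(* Main.v *)
Require Import Defs.
From mathcomp Require Import finmap.
From mathcomp Require Import all_boot all_order all_algebra.
From mathcomp Require Import all_classical all_reals all_analysis.
From mathcomp Require Import zify ring lra.
Import Order.TTheory GRing.Theory Num.Theory.
Import numFieldNormedType.Exports.
Local Open Scope classical_set_scope.
Local Open Scope ring_scope.

(** The points of H are the real forms of discriminant Delta, and every region
    in the statement is described by the signs of the form at integer vectors:
    H^0 is f(1,0) > 0 > f(0,1), and the rhombus H^{p/q} is
    f(q,p) > 0 > f(-p,q) ([rhombusE]).

    Domains. In one of the four sets G the coefficients m and n have a common
    sign e, and K fixes the quadrant (up to sign) in which f can take the sign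
    -e; by symmetry take it to be the positive one, with e = 1. There a rhombus
    of generation r, if it meets G at all, is the condition f(w) < 0 for a
    primitive vector w of generation r in the Stern-Brocot tree. Write w = a + b
    with a, b its parents, a basis of Z^2 of determinant 1. Since a and b have
    smaller generations, a point of the r-th domain set with f(w) < 0 satisfies
    f(a), f(b) > 0 > f(a+b). These inequalities force f > 0 at the vectors of
    the quadrant outside the open cone of a and b, and every primitive vector
    inside the cone other than w has a generation larger than r
    ([sb_gen_inside]); so the cell that they define lies in the domain set, and
    cells of distinct w are disjoint. A cell is connected, being the radial
    projection of a convex cone, and the values f(v) with v of generation at
    most r do not vanish on the domain set, so the cells are its connected
    components ([component_cell]).

    Counting.  The matrix with columns a, b is in SL(2,Z), so it maps the points
    of an orbit in a cell to the forms h of the orbit with e m, e n > 0 and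
    e (m + n + k) < 0, the same set for all cells of a given e.  For e = 1 the
    operator A maps it bijectively to the points of the orbit in H^0 that have
    m + n - k > 0, and these are the points of H^0 at which B has just been
    applied.  For e = -1 one exchanges A and B.

    Chains.  It remains to see that the chain from f contains all points of the
    orbit in H^0.  The condition on the initial point makes f equal to
    (x + y)(m x + n y) with m - n = rho.  A form of the orbit is the product of
    the transformed factors, p x + q y and p' x + q' y, with p, q coprime and
    p q' - q p' = - rho; lying in H^0 forces p, q to have the same sign.  The
    subtractive Euclidean algorithm on (p, q) is the application of the inverses
    of A and B, it stays in H^0, and it stops at p = q = 1, where only f is
    possible ([chain_exhausts_orbit]).  Finally, a word in A and B that leaves
    H^0 never comes back, so a word that takes f to g is the word of the chain
    ([chain_word]). *)

(** * Words in A and B along a chain *)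

Definition inH0 (h : good_point) : bool :=
  let: (m, n, k) := h in (0 < m) && (n < 0).
(** The value at (1,1). On H^0 its sign tells which of A and B stays inside. *)
Definition val_sum (h : good_point) : int :=
  let: (m, n, k) := h in m + n + k.
(** The value at (1,-1). On H^0 its sign tells which of the inverses of A and B
    stays inside, that is, which generator produced the point. *)
Definition val_diff (h : good_point) : int :=
  let: (m, n, k) := h in m + n - k.
Definition disc (h : good_point) : int :=
  let: (m, n, k) := h in k ^+ 2 - 4 * m * n.
Definition chain_step (h h' : good_point) : bool := (h' == opA h) || (h' == opB h).
(** Where a word ends up once it leaves H^0: a region preserved by A and B. *)
Definition trapped (h : good_point) : bool :=
  let: (m, n, k) := h in
  [&& 0 <= m, 0 <= n & 0 <= k] || [&& m <= 0, n <= 0 & k <= 0].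

Lemma inH0_not_trapped h : inH0 h -> ~~ trapped h.
Proof. by case: h => [[m n] k] /=; lia. Qed.

Lemma trapped_gen x h : trapped h -> trapped (gen_op x h).
Proof. by case: x; case: h => [[m n] k] /=; lia. Qed.

Lemma trapped_gen_prod w h : trapped h -> trapped (gen_prod w h).
Proof. by move=> th; elim: w => //= x w; apply: trapped_gen. Qed.

Lemma inH0_opA h : inH0 h -> inH0 (opA h) = (val_sum h < 0).
Proof. by case: h => [[m n] k] /=; lia. Qed.

Lemma inH0_opB h : inH0 h -> inH0 (opB h) = (0 < val_sum h).
Proof. by case: h => [[m n] k] /=; lia. Qed.

Lemma exit_trapped x h : inH0 h -> ~~ inH0 (gen_op x h) -> trapped (gen_op x h).
Proof. by case: x; case: h => [[m n] k] /=; lia. Qed.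

Lemma gen_prod_rcons w x h : gen_prod (rcons w x) h = gen_prod w (gen_op x h).
Proof. by elim: w => //= y w ->. Qed.

Lemma chain_step_det h h1 h2 :
  inH0 h -> inH0 h1 -> inH0 h2 -> chain_step h h1 -> chain_step h h2 -> h1 = h2.
Proof.
move=> Hh H1 H2 /orP[]/eqP e1 /orP[]/eqP e2; rewrite ?e1 ?e2 // in H1 H2 *.
all: by move: H1 H2; rewrite (inH0_opA _ Hh) (inH0_opB _ Hh); lia.
Qed.

Lemma chain_step_val_sum h h' : inH0 h -> inH0 h' -> chain_step h h' -> val_sum h != 0.
Proof.
by move=> Hh H1 /orP[]/eqP e; move: H1; rewrite e (inH0_opA, inH0_opB) //; lia.
Qed.

(** A path in H^0 is forced at each step, and [val_sum] vanishes exactly when it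
    cannot be continued. *)
Lemma maximal_path_unique f s1 s2 :
  all inH0 (f :: s1) -> all inH0 (f :: s2) -> path chain_step f s1 -> path chain_step f s2 ->
  val_sum (last f s1) = 0 -> val_sum (last f s2) = 0 -> s1 = s2.
Proof.
elim: s1 s2 f => [|x s1 IH] [|y s2] f //=.
- move=> _ /and3P[Hf Hy _] _ /andP[fy _] u0 _.
  by have := chain_step_val_sum _ _ Hf Hy fy; rewrite u0.
- move=> /and3P[Hf Hx _] _ /andP[fx _] _ _ u0.
  by have := chain_step_val_sum _ _ Hf Hx fx; rewrite u0.
move=> /and3P[Hf Hx H1] /and3P[_ Hy H2] /andP[fx p1] /andP[fy p2] u1 u2.
have xy := chain_step_det _ _ _ Hf Hx Hy fx fy; rewrite -xy in H2 p2 u2 Hy *.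
by congr (_ :: _); apply: (IH _ x) => //=; rewrite Hx.
Qed.

(** A repeated point would start two maximal paths of different lengths. *)
Lemma chain_uniq f s :
  all inH0 (f :: s) -> path chain_step f s -> val_sum (last f s) = 0 -> uniq (f :: s).
Proof.
elim: s f => [//|x s IH] f aH pth u0.
rewrite cons_uniq; apply/andP; split; last first.
  by move: aH pth => /= /andP[_ aH] /andP[_ pth]; apply: IH.
apply/negP => fs; case/splitPr: fs aH pth u0 => p1 p2 aH pth u0.
have e : p2 = p1 ++ f :: p2.
  apply: (maximal_path_unique f) => //.
  - by move: aH; rewrite /= all_cat /= => /and3P[-> _ /andP[]].
  - by move: pth; rewrite cat_path /= => /and3P[].
  - by move: u0; rewrite last_cat.
by have := congr1 size e; rewrite size_cat /=; lia.
Qed.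

(** A word that leaves H^0 is trapped outside, so each of its generators makes the
    unique step of the chain; the type of a generator can be read off from the
    point that it produces. *)
Lemma chain_word f s w :
  all inH0 (f :: s) -> path chain_step f s -> val_sum (last f s) = 0 ->
  gen_prod w f = last f s ->
  [/\ size w = size s, count is_A w = count (fun h => val_diff h < 0) s &
      count is_B w = count (fun h => 0 < val_diff h) s].
Proof.
elim: s f w => [|y s IH] f w /=.
  move=> /andP[Hf _] _ u0; case/lastP: w => [//|w x]; rewrite gen_prod_rcons.
  move=> e; have /negP[] := inH0_not_trapped _ Hf.
  rewrite -e; apply/trapped_gen_prod/exit_trapped => //.
  by case: {e} x => /=; rewrite (inH0_opA, inH0_opB) // u0.
move=> /and3P[Hf Hy Hs] /andP[fy pth] u0.
have Hl : inH0 (last y s).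
  by have /allP : all inH0 (y :: s) by [rewrite /= Hy]; apply; apply: mem_last.
case/lastP: w => [/= e|w x].
  by have := chain_step_val_sum _ _ Hf Hy fy; rewrite e u0.
rewrite gen_prod_rcons => e.
have Hx : inH0 (gen_op x f).
  apply: contraT => nH; have /negP[] := inH0_not_trapped _ Hl.
  by rewrite -e; apply/trapped_gen_prod/exit_trapped.
have ey : gen_op x f = y.
  apply: (chain_step_det f) => //.
  by rewrite /chain_step; case: {e Hx} x; rewrite /= eqxx ?orbT.
have [||||es eA eB] := IH y w => //=; [by rewrite Hy|by rewrite -e ey|].
rewrite size_rcons -!cats1 !count_cat /= es eA eB -ey.
case: {e Hx ey} x => /=; case: f Hf {fy} => [[m n] k] /= Hf; split=> //; lia.
Qed.

Lemma calTplus_word T : calTplus T -> exists w, T = gen_prod w.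
Proof.
elim=> [|||{}T U _ [w ->] _ [w' ->]].
- by exists [::].
- by exists [:: GenA].
- by exists [:: GenB].
- exists (w ++ w'); apply/funext => h /=.
  by elim: w => //= x w ->.
Qed.

(** * The orbit of the initial point of a chain *)

Definition form_subst (a b c d : int) (h : good_point) : good_point :=
  let: (m, n, k) := h in
  (m * a ^+ 2 + n * c ^+ 2 + k * a * c, m * b ^+ 2 + n * d ^+ 2 + k * b * d,
   2 * m * a * b + 2 * n * c * d + k * (a * d + b * c)).

Lemma det_mx22 (L : 'M[int]_2) : \det L = L 0 0 * L 1 1 - L 0 1 * L 1 0.
Proof.
rewrite (expand_det_row _ 0) !big_ord_recl big_ord0 /cofactor !det_mx11 !mxE /=.
have -> : lift ord0 ord0 = 1 :> 'I_2 by apply/val_inj.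
have -> : lift 1 0 = 0 :> 'I_2 by apply/val_inj.
have -> : ord0 = 0 :> 'I_2 by apply/val_inj.
rewrite /bump /=; ring.
Qed.

Lemma form_actE_subst (L : 'M[int]_2) h :
  form_act L h = form_subst (L 0 0) (L 0 1) (L 1 0) (L 1 1) h.
Proof. by case: h => [[m n] k]; rewrite /form_act /form_eval !mxE. Qed.

Lemma orbitP f h :
  orbit_of f h <->
  exists a b c d : int, a * d - b * c = 1 /\ h = form_subst a b c d f.
Proof.
split=> [[_ [L /= dL <-] <-]|[a [b [c [d [e ->]]]]]].
  exists (L 0 0), (L 0 1), (L 1 0), (L 1 1); split; last exact: form_actE_subst.
  by rewrite -dL det_mx22.
pose L : 'M[int]_2 := \matrix_(i, j)
  (if i == 0 then if j == 0 then a else b else if j == 0 then c else d).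
exists (form_act L); last by rewrite form_actE_subst !mxE.
by exists L => //=; rewrite det_mx22 !mxE.
Qed.

Lemma form_subst_comp a b c d a' b' c' d' h :
  form_subst a' b' c' d' (form_subst a b c d h) =
  form_subst (a * a' + b * c') (a * b' + b * d')
             (c * a' + d * c') (c * b' + d * d') h.
Proof. by case: h => [[m n] k]; congr (_, _, _); ring. Qed.

Lemma orbit_subst a b c d f h : a * d - b * c = 1 ->
  orbit_of f (form_subst a b c d h) <-> orbit_of f h.
Proof.
move=> e; split=> /orbitP[a' [b' [c' [d' [e' E]]]]]; apply/orbitP; last first.
  rewrite E form_subst_comp; do 4 eexists; split; last reflexivity.
  transitivity ((a * d - b * c) * (a' * d' - b' * c')); [ring|by rewrite e e' mulr1].
have -> : h = form_subst d (- b) (- c) a (form_subst a b c d h).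
  rewrite form_subst_comp.
  have -> : a * d + b * - c = 1 by rewrite -e; ring.
  have -> : c * - b + d * a = 1 by rewrite -e; ring.
  by case: h {E} => [[m n] k]; congr (_, _, _); ring.
rewrite E form_subst_comp; do 4 eexists; split; last reflexivity.
transitivity ((a * d - b * c) * (a' * d' - b' * c')); [ring|by rewrite e e' mulr1].
Qed.

Lemma opAE h : opA h = form_subst 1 1 0 1 h.
Proof. by case: h => [[m n] k]; congr (_, _, _); ring. Qed.
Lemma opBE h : opB h = form_subst 1 0 1 1 h.
Proof. by case: h => [[m n] k]; congr (_, _, _); ring. Qed.

Lemma orbit_opA f h : orbit_of f (opA h) <-> orbit_of f h.
Proof. by rewrite opAE; apply: orbit_subst. Qed.
Lemma orbit_opB f h : orbit_of f (opB h) <-> orbit_of f h.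
Proof. by rewrite opBE; apply: orbit_subst. Qed.

Lemma orbit_chain_step f h h' : chain_step h h' -> orbit_of f h -> orbit_of f h'.
Proof.
by move=> /orP[]/eqP -> ?; [apply/orbit_opA|apply/orbit_opB].
Qed.

Lemma orbit_refl f : orbit_of f f.
Proof.
apply/orbitP; exists 1, 0, 0, 1; split=> //.
by case: f => [[m n] k]; congr (_, _, _); ring.
Qed.

Lemma orbit_disc f h : orbit_of f h -> disc h = disc f.
Proof.
move=> /orbitP[a [b [c [d [e ->]]]]]; case: f => [[m n] k] /=.
transitivity ((k ^+ 2 - 4 * m * n) * (a * d - b * c) ^+ 2); first by ring.
by rewrite e; ring.
Qed.

Lemma orbit_path f h s : path chain_step h s -> orbit_of f h ->
  forall x, x \in h :: s -> orbit_of f x.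
Proof.
elim: s h => [|y s IH] h /=; first by move=> _ oh x; rewrite inE => /eqP->.
move=> /andP[hy pth] oh x; rewrite inE => /orP[/eqP->//|].
by apply: IH => //; apply: orbit_chain_step oh.
Qed.

(** No step from the last point stays in H^0, and from any other point only the
    step to the next one does. *)
Lemma path_chain_step_closed f s h h' :
  all inH0 (f :: s) -> path chain_step f s -> val_sum (last f s) = 0 ->
  h \in f :: s -> chain_step h h' -> inH0 h' -> h' \in f :: s.
Proof.
elim: s f => [|y s IH] f.
  rewrite inE /= => /andP[Hf _] _ u0 /eqP-> fh' Hh'.
  by have := chain_step_val_sum _ _ Hf Hh' fh'; rewrite u0.
rewrite /= => /and3P[Hf Hy Hs] /andP[fy pth] u0; rewrite in_cons => /orP[/eqP->|].
  move=> fh' Hh'; rewrite (chain_step_det _ _ _ Hf Hh' Hy fh' fy).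
  by rewrite !inE eqxx orbT.
move=> hs hh' Hh'; rewrite in_cons; apply/orP; right; apply: IH hh' Hh' => //.
by rewrite /= Hy.
Qed.

Lemma mul_eq1_pos (x y : int) : 0 < x -> x * y = 1 -> x = 1 /\ y = 1.
Proof.
move=> x0 e; have y0 : 0 < y by rewrite -(pmulr_rgt0 _ x0) e.
suff x1 : x = 1 by move: e; rewrite x1 mul1r.
by nia.
Qed.

(** Uniqueness of the representative of a residue class modulo [r] in an interval
    of length [r]. *)
Lemma floor_eq1 (r n a : int) : 0 < r -> - r < n < 0 ->
  0 < r * a + n -> r * (a - 1) + n < 0 -> a = 1.
Proof.
move=> r0 rn h1 h2; have [a1|a1|//] := ltrgtP a 1; nia.
Qed.

(** Subtractive Euclidean algorithm on the linear factor p x + q y that comes from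
    the factor x + y of [f]. *)
Lemma chain_exhausts_orbit (rho : int) f s h : 0 < rho ->
  all inH0 (f :: s) -> path chain_step f s -> val_sum (last f s) = 0 ->
  val_diff f = 0 -> disc f = rho ^+ 2 ->
  orbit_of f h -> inH0 h -> h \in f :: s.
Proof.
move=> rho_gt0 aH pth u0 v0 df /orbitP[a [b [c [d [e ->]]]]].
have [Hf _] := andP aH.
(* L and - L act in the same way, so the sign of p = a + c is free. *)
wlog pos : a b c d e / 0 < a + c.
  move=> IH Hh; case: (ltrgtP 0 (a + c)) => pq; first exact: IH.
    have -> : form_subst a b c d f = form_subst (- a) (- b) (- c) (- d) f.
      by case: (f) => [[m n] k]; congr (_, _, _); ring.
    apply: IH; [by rewrite -e; ring|lia|].
    suff -> : form_subst (- a) (- b) (- c) (- d) f = form_subst a b c d f by [].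
    by case: (f) => [[m n] k]; congr (_, _, _); ring.
  suff : ~~ inH0 (form_subst a b c d f) by rewrite Hh.
  case: f aH pth u0 v0 df Hf {Hh IH} => [[m n] k] /= _ _ _ v0 _ Hf.
  have -> : c = - a by lia.
  have -> : k = m + n by lia.
  have -> : m * a ^+ 2 + n * (- a) ^+ 2 + (m + n) * a * - a = 0 by ring.
  by [].
case: f aH pth u0 v0 df Hf => [[m n] k].
have [N] := ubnP (absz (a + c + (b + d))).
elim: N a b c d e pos => // N IH a b c d e p0 leN aH pth u0 v0 df Hf Hh.
have km : k = m + n by move: v0 => /=; lia.
have mn : m - n = rho.
  move: df => /= df; move: Hf => /=; rewrite km in df; nia.
pose p := a + c; pose q := b + d; pose p' := m * a + n * c; pose q' := m * b + n * d.
have hE : form_subst a b c d (m, n, k) = (p * p', q * q', p * q' + q * p').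
  by rewrite /p /q /p' /q' km; congr (_, _, _); ring.
have Epq : p * q' - q * p' = - rho.
  transitivity ((n - m) * (a * d - b * c)); first by rewrite /p/q/p'/q'; ring.
  by rewrite e; lia.
have p'0 : 0 < p'.
  by move: Hh; rewrite hE /= => /andP[+ _]; rewrite pmulr_rgt0.
have [q0 q'0] : 0 < q /\ q' < 0.
  move: Hh; rewrite hE /= => /andP[_ qq'].
  have [q0|q0|q0] := ltrgtP 0 q.
  - by split=> //; rewrite -(pmulr_rlt0 _ q0).
  - have q'0 : 0 < q' by rewrite -(nmulr_rlt0 _ q0).
    suff : 0 < p * q' - q * p' by lia.
    by rewrite subr_gt0 (lt_trans (y := 0)) ?mulr_gt0 // nmulr_rlt0.
  - by move: qq'; rewrite -q0 mul0r.
(* Modulo q - p this is the coprimality of p and q. *)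
have Epq' : p * (a - b) + a * (q - p) = 1 by rewrite -e /p /q; ring.
have [pq|pq|pq] := ltrgtP p q.
- apply: (@path_chain_step_closed _ _ (form_subst a (b - a) c (d - c) (m, n, k))) => //.
  + apply: IH => //; [by rewrite -e; ring|by rewrite /p /q in p0 q0 pq leN; lia|].
    have -> : form_subst a (b - a) c (d - c) (m, n, k) =
      (p * p', (q - p) * (q' - p'), p * (q' - p') + (q - p) * p').
      by rewrite /p /q /p' /q' km; congr (_, _, _); ring.
    by rewrite /= mulr_gt0 //= pmulr_rlt0; lia.
  + by rewrite /chain_step opAE form_subst_comp; apply/orP; left; apply/eqP;
      case: (m, n, k) => [[? ?] ?]; congr (_, _, _); ring.
- apply: (@path_chain_step_closed _ _ (form_subst (a - b) b (c - d) d (m, n, k))) => //.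
  + have pq0 : 0 < a - b + (c - d) by rewrite /p /q in pq *; lia.
    apply: IH => //; [by rewrite -e; ring|by rewrite /p /q in p0 q0 pq leN; lia|].
    have -> : form_subst (a - b) b (c - d) d (m, n, k) =
      ((p - q) * (p' - q'), q * q', (p - q) * q' + q * (p' - q')).
      by rewrite /p /q /p' /q' km; congr (_, _, _); ring.
    by rewrite /= mulr_gt0 //=; [rewrite pmulr_rlt0; lia|lia|lia].
  + by rewrite /chain_step opBE form_subst_comp; apply/orP; right; apply/eqP;
      case: (m, n, k) => [[? ?] ?]; congr (_, _, _); ring.
have [p1 ab] : p = 1 /\ a - b = 1.
  by apply: mul_eq1_pos => //; rewrite -Epq' pq subrr mulr0 addr0.
have [a1 [b0 [c0 d1]]] : a = 1 /\ b = 0 /\ c = 0 /\ d = 1.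
  have q1 : q = 1 by rewrite -pq.
  rewrite /p' /q' /p /q in p'0 q'0 p1 q1.
  have eb : b = a - 1 by lia.
  have ec : c = 1 - a by lia.
  have ed : d = 2 - a by lia.
  rewrite {}eb {}ec {}ed in p'0 q'0 *.
  suff : a = 1 by lia.
  have eA : m * a + n * (1 - a) = rho * a + n by rewrite -mn; ring.
  have eB : m * (a - 1) + n * (2 - a) = rho * (a - 1) + n by rewrite -mn; ring.
  rewrite eA in p'0; rewrite eB in q'0.
  by apply: (@floor_eq1 rho n) => //; move: Hf => /=; lia.
rewrite a1 b0 c0 d1.
suff -> : form_subst 1 0 0 1 (m, n, k) = (m, n, k) by rewrite mem_head.
by congr (_, _, _); ring.
Qed.

(** * Counting points of the orbit by reduced forms *)

Lemma card_set_uniq (T : choiceType) (s : seq T) :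
  uniq s -> ([set x | x \in s] #= `I_(size s))%card.
Proof.
move=> us; rewrite -{2}(undup_id us) -card_fseq.
have -> : [set x | x \in s] = [set` [fset x in s]%fset].
  by apply/seteqP; split=> x /=; rewrite inE.
exact/card_eq_fsetP.
Qed.

(** The two roots lie in the first quadrant, on either side of the direction (1,1).
    An element of SL(2,Z) carries the integer points of any cell of sign [e] to
    such forms. *)
Definition reduced (e : int) (h : good_point) : bool :=
  let: (m, n, k) := h in [&& 0 < e * m, 0 < e * n & e * (m + n + k) < 0].

(** Substitutions of determinant 1 permute the orbit. *)
Lemma card_reduced_subst f e a b c d n : a * d - b * c = 1 ->
  ([set h | orbit_of f h /\ reduced e h] #= `I_n ->
   [set h | orbit_of f h /\ reduced e (form_subst a b c d h)] #= `I_n)%card.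
Proof.
move=> det1 card_n.
pose inv := form_subst d (- b) (- c) a.
have invK : cancel (form_subst a b c d) inv.
  move=> h; rewrite /inv form_subst_comp.
  have -> : a * d + b * - c = 1 by rewrite -det1; ring.
  have -> : c * - b + d * a = 1 by rewrite -det1; ring.
  by case: h => [[? ?] ?]; congr (_, _, _); ring.
have Kinv : cancel inv (form_subst a b c d).
  move=> h; rewrite /inv form_subst_comp.
  have -> : d * a + - b * c = 1 by rewrite -det1; ring.
  have -> : - c * b + a * d = 1 by rewrite -det1; ring.
  by case: h => [[? ?] ?]; congr (_, _, _); ring.
apply: card_eq_trans card_n.
rewrite (_ : [set h | _] = inv @` [set h | orbit_of f h /\ reduced e h]).
  by apply: inj_card_eq => x y _ _; apply: can_inj Kinv _ _.
apply/seteqP; split=> [h [oh bh]|_ [h [oh bh] <-]] /=.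
  exists (form_subst a b c d h) => //; split=> //; exact/orbit_subst.
by split; [apply/(orbit_subst a b c d) => //; rewrite Kinv|rewrite Kinv].
Qed.

Section Counting.
Variables (rho : int) (f : good_point) (s : seq good_point).
Hypotheses (rho0 : 0 < rho) (aH : all inH0 (f :: s)) (pth : path chain_step f s)
  (u0 : val_sum (last f s) = 0) (v0 : val_diff f = 0) (df : disc f = rho ^+ 2).

(** The common pattern of the two counts: [op] maps the forms satisfying [P] onto
    the points of H^0 that satisfy [Q]. *)
Lemma card_orbit_chain (P : pred good_point) (op opbar : good_point -> good_point)
    (Q : pred good_point) :
  cancel op opbar -> cancel opbar op ->
  (forall h, orbit_of f (op h) <-> orbit_of f h) ->
  (forall h, P h = inH0 (op h) && Q (op h)) -> ~~ Q f ->
  ([set h | orbit_of f h /\ P h] #= `I_(count Q s))%card.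
Proof.
move=> opK opbarK orb PQ Qf.
have := card_set_uniq _ [seq x <- f :: s | Q x].
rewrite filter_uniq ?(chain_uniq _ _ aH pth u0) // size_filter /= (negbTE Qf) add0n.
move=> /(_ isT); apply: card_eq_trans.
rewrite (_ : [set h | _ /\ _] = opbar @` [set x | x \in [seq x <- s | Q x]]).
  by apply: inj_card_eq => x y _ _; apply: can_inj opbarK _ _.
apply/seteqP; split=> [h [oh]|_ [x /= + <-]] /=.
  rewrite PQ => /andP[Hh Qh]; exists (op h); last exact: opK.
  have : op h \in [seq x <- f :: s | Q x].
    rewrite mem_filter Qh; apply: (chain_exhausts_orbit rho) => //; exact/orb.
  by rewrite /= (negbTE Qf).
rewrite mem_filter => /andP[Qx xs].
have xfs : x \in f :: s by rewrite inE xs orbT.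
split; last by rewrite PQ opbarK Qx andbT; exact: (allP aH).
by apply/orb; rewrite opbarK; exact: (orbit_path f f s pth (orbit_refl f)).
Qed.

Lemma card_reduced_pos :
  ([set h | orbit_of f h /\ reduced 1 h] #= `I_(count (fun h => 0 < val_diff h)%R s))%card.
Proof.
apply: (card_orbit_chain _ opA opAbar _ opAK opAbarK); last by rewrite v0.
- by move=> h; apply: orbit_opA.
- by case=> [[m n] k] /=; lia.
Qed.

Lemma card_reduced_neg :
  ([set h | orbit_of f h /\ reduced (-1) h] #= `I_(count (fun h => val_diff h < 0)%R s))%card.
Proof.
apply: (card_orbit_chain _ opB opBbar _ opBK opBbarK); last by rewrite v0.
- by move=> h; apply: orbit_opB.
- by case=> [[m n] k] /=; lia.
Qed.

End Counting.

(** * The Stern-Brocot tree and the generations *)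

(** The two maps on fractions as maps on pairs (numerator, denominator), so that
    they extend to 0/1 and 1/0. *)
Definition sb_step (b : bool) (v : int * int) : int * int :=
  if b then (v.1 + v.2, v.2) else (v.1, v.1 + v.2).
Definition sb_act (w : seq bool) (v : int * int) : int * int := foldr sb_step v w.

Definition sb_gen (n : nat) : set (int * int) :=
  if n is n'.+1 then [set sb_act w (1, 1) | w in [set w : seq bool | size w = n']]
  else [set (0, 1); (1, 0)].

Lemma sb_act_lin w (x y : int) :
  sb_act w (x, y) = (x * (sb_act w (1, 0)).1 + y * (sb_act w (0, 1)).1,
                     x * (sb_act w (1, 0)).2 + y * (sb_act w (0, 1)).2).
Proof.
elim: w x y => [|b w IH] x y /=; first by congr (_, _); ring.
by rewrite IH; case: b => /=; congr (_, _); ring.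
Qed.

Lemma sb_act_det w :
  (sb_act w (1, 0)).1 * (sb_act w (0, 1)).2
  - (sb_act w (0, 1)).1 * (sb_act w (1, 0)).2 = 1.
Proof.
elim: w => [|b w IH] /=; first by ring.
by rewrite -[RHS]IH; case: b => /=; ring.
Qed.

Lemma sb_act_ge0 w (v : int * int) : 0 <= v.1 -> 0 <= v.2 ->
  0 <= (sb_act w v).1 /\ 0 <= (sb_act w v).2.
Proof.
move=> v1 v2; elim: w => [//|b w [h1 h2]].
by case: b => /=; split=> //; apply: addr_ge0.
Qed.

Lemma sb_act_gt0 w (v : int * int) : 0 < v.1 -> 0 < v.2 ->
  0 < (sb_act w v).1 /\ 0 < (sb_act w v).2.
Proof.
move=> v1 v2; elim: w => [//|b w [h1 h2]].
by case: b => /=; split=> //; apply: addr_gt0.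
Qed.

Lemma sb_gen_step b n v : sb_gen n v -> exists2 i, (i <= n.+1)%N & sb_gen i (sb_step b v).
Proof.
case: n => [|n] /=.
  case=> ->; case: b.
  - by exists 1%N => //; exists [::].
  - by exists 0%N => //; left.
  - by exists 0%N => //; right.
  - by exists 1%N => //; exists [::].
by move=> [w sw <-]; exists n.+2 => //; exists (b :: w) => //=; rewrite sw.
Qed.

(** A step raises the generation by at most one. So the columns of the matrix of
    [w], the parents of its vector, come before that vector, whose generation is
    one more than the length of [w]. *)
Lemma sb_gen_parent w v : sb_gen 0 v ->
  exists2 i, (i <= size w)%N & sb_gen i (sb_act w v).
Proof.
move=> v0; elim: w => [|b w [i iw gi]]; first by exists 0%N.
have [j ji gj] := sb_gen_step b _ _ gi.
by exists j => //; apply: leq_trans ji _.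
Qed.

Lemma sb_gen_ge0 n v : sb_gen n v -> 0 <= v.1 /\ 0 <= v.2.
Proof.
case: n => [[]->//|n /= [w _ <-]]; exact: sb_act_ge0.
Qed.

Lemma sb_gen_gt0 n v : sb_gen n.+1 v -> 0 < v.1 /\ 0 < v.2.
Proof. by move=> [w _ <-]; exact: sb_act_gt0. Qed.

Lemma sb_gen_neq0 n : ~ sb_gen n (0, 0).
Proof.
case: n => [[] //|n [w _ e]].
by have [] := sb_act_gt0 w (1, 1) ltr01 ltr01; rewrite e.
Qed.

(** Comparing the coordinates of a vector gives the last step on both sides, so
    the two words agree as long as both last. *)
Lemma sb_act_inside w w' (x y : int) : 0 < x -> 0 < y ->
  sb_act w' (1, 1) = sb_act w (x, y) ->
  (size w <= size w')%N /\ (size w = size w' -> w = w').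
Proof.
move=> x0 y0; elim: w w' => [|b w IH] [|b' w'] //=.
  have [] := sb_act_gt0 w (x, y) x0 y0.
  by case: b => /= h1 h2 []; lia.
have [h1 h2] := sb_act_gt0 w (x, y) x0 y0.
have [h1' h2'] := sb_act_gt0 w' (1, 1) ltr01 ltr01.
move=> e; suff [bb /IH[le_w eq_w]] : b = b' /\ sb_act w' (1, 1) = sb_act w (x, y).
  by split=> // -[/eq_w <-]; rewrite bb.
case: (sb_act w' (1, 1)) (sb_act w (x, y)) h1 h2 h1' h2' e => [p q] [p' q'] /=.
by case: b b' => -[] /= h1 h2 h1' h2' []; rewrite ?pair_equal_spec; lia.
Qed.

(** The mediant is the unique vector of smallest generation in the open cone
    spanned by its parents. *)
Lemma sb_gen_inside w n v (x y : int) : 0 < x -> 0 < y -> sb_gen n v ->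
  v = sb_act w (x, y) ->
  (size w < n)%N /\ (n = (size w).+1 -> v = sb_act w (1, 1)).
Proof.
move=> x0 y0; case: n => [|n].
  have [h1 h2] := sb_act_gt0 w (x, y) x0 y0.
  by case=> -> e; rewrite -e in h1 h2.
move=> [w' <- <-] e; have [le_w eq_w] := sb_act_inside _ _ _ _ x0 y0 e.
by split=> // -[/esym /eq_w ->].
Qed.

Lemma sb_act_surj w v : exists x y, v = sb_act w (x, y).
Proof.
have e := sb_act_det w.
exists (v.1 * (sb_act w (0, 1)).2 - v.2 * (sb_act w (0, 1)).1).
exists (v.2 * (sb_act w (1, 0)).1 - v.1 * (sb_act w (1, 0)).2).
rewrite sb_act_lin; case: v => v1 v2 /=; congr (_, _).
- rewrite -[LHS]mulr1 -[in LHS]e; ring.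
- rewrite -[LHS]mulr1 -[in LHS]e; ring.
Qed.

Lemma sb_gen_swap n v : sb_gen n v -> sb_gen n (v.2, v.1).
Proof.
case: n => [|n] /=; first by case=> -> /=; [right|left].
move=> [w sw <-]; exists (map negb w); first by rewrite /= size_map.
elim: {sw} w => [//|b w IH] /=; rewrite IH.
by case: b => /=; congr (_, _); rewrite addrC.
Qed.

Lemma sb_coprime w : coprimez (sb_act w (1, 1)).1 (sb_act w (1, 1)).2.
Proof.
elim: w => [//|[] w IH]; rewrite /coprimez /=; last by rewrite gcdzDl.
by rewrite gcdzC gcdzDr gcdzC.
Qed.

Lemma foldr_gen_step w : 0 < foldr gen_step 1 w /\
  (numq (foldr gen_step 1 w), denq (foldr gen_step 1 w)) = sb_act w (1, 1).
Proof.
have [h1 h2] := sb_act_gt0 w (1, 1) ltr01 ltr01.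
have -> : foldr gen_step 1 w = (sb_act w (1, 1)).1%:Q / (sb_act w (1, 1)).2%:Q.
  elim: w {h1 h2} => [//|b w /= ->].
  have [] := sb_act_gt0 w (1, 1) ltr01 ltr01.
  case: (sb_act w (1, 1)) => p q /= p0 q0.
  have p0' : 0 < p%:Q by rewrite ltr0z.
  have q0' : 0 < q%:Q by rewrite ltr0z.
  case: b => /=; rewrite intrD; field; last by rewrite !gt_eqF // addr_gt0.
  by rewrite gt_eqF.
split; first by rewrite divr_gt0 // ltr0z.
have co := sb_coprime w; rewrite coprimezE in co.
rewrite coprimeq_num // coprimeq_den // gt_eqF // gtr0_sg // gtr0_norm // mul1r.
by case: (sb_act w (1, 1)).
Qed.

(** The tree lives in the first quadrant, but for two of the four sets G the roots
    of the forms lie in the fourth one. *)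
Definition flip (sg : int) (v : int * int) : int * int := (v.1, sg * v.2).

Lemma generation_sb n x : generation n x ->
  exists sg v, [/\ sg = 1 \/ sg = -1, sb_gen n v & x = (sg * v.1, v.2)].
Proof.
case: n => [|n]; first by move=> gx; exists 1, x; rewrite mul1r; split=> //; [left|case: (x)].
move=> [y [w [sw ey]] <-]; have [x0 xE] := foldr_gen_step w.
have [y0|y0] := lerP 0 y.
  exists 1, (sb_act w (1, 1)); split; [by left|by exists w|].
  by rewrite -xE /= -ey ger0_norm // mul1r.
exists (-1), (sb_act w (1, 1)); split; [by right|by exists w|].
by rewrite -xE /= -ey ltr0_norm // mulN1r numqN denqN opprK.
Qed.

Lemma sb_generation n sg v : sg = 1 \/ sg = -1 -> sb_gen n.+1 v ->
  generation n.+1 (sg * v.1, v.2).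
Proof.
move=> sgE [w sw <-]; have [x0 xE] := foldr_gen_step w; rewrite -xE /=.
case: sgE => ->.
  exists (foldr gen_step 1 w); last by rewrite mul1r.
  by exists w; rewrite gtr0_norm.
exists (- foldr gen_step 1 w); last by rewrite numqN denqN mulN1r.
by exists w; rewrite normrN gtr0_norm.
Qed.

(** * Signs of a form at integer vectors *)

Section Geometry.
Variable R : realType.
Implicit Types (P Q : R * R * R) (v : int * int) (e sg : int).

(** Twice the value at [v] of the form with coordinates [P]; the factor 2 avoids
    halves, as m = (S + D)/2 and n = (S - D)/2. *)
Definition form_at P v : R :=
  (coordS P + coordD P) * v.1%:~R ^+ 2 + (coordS P - coordD P) * v.2%:~R ^+ 2
  + 2 * coordK P * v.1%:~R * v.2%:~R.

Definition sdisc P : R := coordK P ^+ 2 + coordD P ^+ 2 - coordS P ^+ 2.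

(** On H these are the four sets G: [e] is the common sign of m and n, and [sg]
    is the sign of x y for the vectors (x, y) at which the form can take the
    sign - [e]. *)
Definition quadrant e sg : set (R * R * R) :=
  [set P | [/\ 0 < e%:~R * (coordS P + coordD P), 0 < e%:~R * (coordS P - coordD P)
             & e%:~R * sg%:~R * coordK P < 0]].

Definition is_sign e := e = 1 \/ e = -1.

Lemma form_atN P v : form_at P (- v.1, - v.2) = form_at P v.
Proof. by rewrite /form_at /= !intrN; ring. Qed.

Lemma form_at_KDS h (a b : int) :
  form_at (KDS R h) (a, b) =
  2 * (h.1.1 * a ^+ 2 + h.1.2 * b ^+ 2 + h.2 * a * b)%:~R.
Proof.
case: h => [[m n] k]; rewrite /form_at /KDS /coordK /coordD /coordS /=.
by rewrite !expr2 !(intrD, intrM, intrN); ring.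
Qed.

(** The two bounds contained in the absolute value are the values of the form at
    the vector (q,p) and at the orthogonal vector (-p,q). *)
Lemma rhombusE (Delta : R) x P : rhombus Delta x P <->
  [/\ hyperboloid Delta P, 0 < form_at P (x.2, x.1) & form_at P (- x.1, x.2) < 0].
Proof.
rewrite /rhombus /form_at /=; set p := x.1%:~R; set q := x.2%:~R.
rewrite intrN -/p.
have n0 : 0 <= p ^+ 2 + q ^+ 2 by rewrite addr_ge0 ?sqr_ge0.
rewrite -[X in X * `|_|]ger0_norm // -normrM ltr_norml.
split=> [[hP /andP[h1 h2]]|[hP h1 h2]]; split=> //.
- by lra.
- by lra.
- by apply/andP; split; lra.
Qed.

(** In the quadrant where x y has the sign - [sg], all three terms of the form have
    the sign [e]. *)
Lemma form_at_quadrant e sg P v : is_sign e -> is_sign sg -> quadrant e sg P ->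
  0 <= v.1 -> 0 <= v.2 -> v != (0, 0) ->
  0 < e%:~R * form_at P (v.1, - (sg * v.2)).
Proof.
case: v => x y es ss [h1 h2 h3] /= x0 y0 xy.
have -> : e%:~R * form_at P (x, - (sg * y)) =
  (e%:~R * (coordS P + coordD P)) * x%:~R ^+ 2 +
  (e%:~R * (coordS P - coordD P)) * y%:~R ^+ 2 +
  2 * (- (e%:~R * sg%:~R * coordK P)) * (x%:~R * y%:~R).
  by rewrite /form_at /= intrN intrM; case: ss => ->; rewrite ?mulrN1z ?mulr1z; ring.
have xR : 0 <= x%:~R :> R by rewrite ler0z.
have yR : 0 <= y%:~R :> R by rewrite ler0z.
apply: ltr_wpDr; first by rewrite !mulr_ge0 // oppr_ge0 ltW.
have [x1|x1] := ltrP 0 x.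
  by apply: ltr_pwDl; [rewrite mulr_gt0 // exprn_gt0 // ltr0z|
     rewrite mulr_ge0 ?sqr_ge0 // ltW].
have y1 : 0 < y.
  rewrite lt_neqAle y0 andbT; apply: contraNneq xy => <-.
  by rewrite (@le_anti _ _ x 0) ?x1.
by apply: ltr_wpDl; [rewrite mulr_ge0 ?sqr_ge0 // ltW|
   rewrite mulr_gt0 // exprn_gt0 // ltr0z].
Qed.

(** A quadratic form is determined by its values at two basis vectors and at their
    sum. *)
Lemma form_at_comb P (sg x y : int) w :
  form_at P (flip sg (sb_act w (x, y))) =
  x%:~R * (x - y)%:~R * form_at P (flip sg (sb_act w (1, 0)))
  + y%:~R * (y - x)%:~R * form_at P (flip sg (sb_act w (0, 1)))
  + x%:~R * y%:~R * form_at P (flip sg (sb_act w (1, 1))).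
Proof.
rewrite (sb_act_lin w x y) (sb_act_lin w 1 1) /flip /form_at /=.
case: (sb_act w (1, 0)) => a1 a2; case: (sb_act w (0, 1)) => b1 b2 /=.
by rewrite !(intrD, intrM, intrN); ring.
Qed.

(** The roots of the form lie in the cone of the parents, on either side of the
    mediant. *)
Definition open_cell e sg w : set (R * R * R) :=
  [set P | [/\ 0 < e%:~R * form_at P (flip sg (sb_act w (1, 0))),
               0 < e%:~R * form_at P (flip sg (sb_act w (0, 1)))
             & e%:~R * form_at P (flip sg (sb_act w (1, 1))) < 0]].

(** In the basis of the parents the cross term of e f is negative, hence it cannot
    make e f negative when the coordinates have opposite signs. *)
Lemma open_cell_outside e sg w P (x y : int) : open_cell e sg w P ->
  x * y <= 0 -> (x, y) != (0, 0) ->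
  0 < e%:~R * form_at P (flip sg (sb_act w (x, y))).
Proof.
move=> [h1 h2 h3] xy nz.
rewrite form_at_comb; move: h1 h2 h3.
set A := _ * form_at P (flip sg (sb_act w (1, 0))).
set B := _ * form_at P (flip sg (sb_act w (0, 1))).
set C := _ * form_at P (flip sg (sb_act w (1, 1))) => h1 h2 h3.
have -> : forall p q r a b c : R, e%:~R * (p * a + q * b + r * c) =
    p * (e%:~R * a) + q * (e%:~R * b) + r * (e%:~R * c).
  by move=> *; ring.
rewrite -/A -/B -/C.
have xyR : x%:~R * y%:~R <= 0 :> R by rewrite -intrM lerz0.
apply: ltr_wpDr; first by rewrite mulr_le0 // ltW.
have x2 : x%:~R * (x - y)%:~R >= x%:~R ^+ 2 :> R by rewrite intrB mulrBr expr2; lra.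
have y2 : y%:~R * (y - x)%:~R >= y%:~R ^+ 2 :> R.
  by rewrite intrB mulrBr expr2 [y%:~R * x%:~R]mulrC; lra.
apply: (@lt_le_trans _ _ (x%:~R ^+ 2 * A + y%:~R ^+ 2 * B)); last first.
  by apply: lerD; apply: ler_wpM2r => //; exact: ltW.
have [x0|x0] := eqVneq x 0.
  apply: ltr_wpDl; first by rewrite mulr_ge0 ?sqr_ge0 // ltW.
  rewrite mulr_gt0 // lt_neqAle sqr_ge0 andbT eq_sym sqrf_eq0 intr_eq0.
  by apply: contra nz => /eqP->; rewrite x0.
apply: ltr_pwDl; last by rewrite mulr_ge0 ?sqr_ge0 // ltW.
by rewrite mulr_gt0 // lt_neqAle sqr_ge0 andbT eq_sym sqrf_eq0 intr_eq0.
Qed.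

(** By [open_cell_outside] the vector is in the open cone of the parents, where the
    mediant comes before all others. *)
Lemma open_cell_gen e sg w P n v : open_cell e sg w P -> sb_gen n v ->
  e%:~R * form_at P (flip sg v) <= 0 ->
  (size w < n)%N /\ (n = (size w).+1 -> v = sb_act w (1, 1)).
Proof.
move=> cP gv fv; have [x [y vE]] := sb_act_surj w v.
have [v1 v2] := sb_gen_ge0 _ _ gv.
suff [x0 y0] : 0 < x /\ 0 < y by apply: (sb_gen_inside w n v x y).
have [xy|xy] := lerP (x * y) 0.
  suff : 0 < e%:~R * form_at P (flip sg v) by rewrite ltNge fv.
  rewrite vE; apply: open_cell_outside => //.
  apply/negP => /eqP xy0; apply: (sb_gen_neq0 n).
  by move: gv; rewrite vE xy0 sb_act_lin !mul0r addr0.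
have [x0|x0|x0] := ltrgtP 0 x.
- by rewrite pmulr_rgt0 // in xy.
- have y0 : y < 0 by rewrite nmulr_rgt0 // in xy.
  have [] := sb_act_gt0 w (- x, - y); rewrite /= ?oppr_gt0 // => h1 _.
  move: v1 h1; rewrite vE (sb_act_lin w x y) (sb_act_lin w (- x) (- y)) /= !mulNr.
  by rewrite -opprD oppr_gt0 leNgt => /negP.
- by rewrite -x0 mul0r in xy.
Qed.

End Geometry.

(** * Rhombi inside a quadrant *)

Section Rhombi.
Variable R : realType.
Implicit Types (P Q : R * R * R) (v : int * int) (e sg : int).

(** The basis vectors (1,0) and (0,1) are never inside the cone of the parents. *)
Lemma open_cell_quadrant e sg w P : is_sign sg ->
  open_cell R e sg w P -> quadrant R e sg P.
Proof.
move=> ss cP; have det1 := sb_act_det w.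
have [a1 a2] := sb_act_ge0 w (1, 0) ler01 (lexx 0).
have [b1 b2] := sb_act_ge0 w (0, 1) (lexx 0) ler01.
have E1 : sb_act w ((sb_act w (0, 1)).2, - (sb_act w (1, 0)).2) = (1, 0).
  by rewrite sb_act_lin; congr (_, _); [rewrite -[RHS]det1|]; ring.
have E2 : sb_act w (- (sb_act w (0, 1)).1, (sb_act w (1, 0)).1) = (0, 1).
  by rewrite sb_act_lin; congr (_, _); [|rewrite -[RHS]det1]; ring.
have h1 : 0 < e%:~R * form_at R P (flip sg (1, 0)).
  rewrite -E1; apply: (open_cell_outside _ _ _ _ _ _ _ cP).
    by rewrite mulrN oppr_le0 mulr_ge0.
  apply: contra_eq_neq E1 => ->; apply/eqP => e0.
  by apply: (sb_gen_neq0 0); left; move: e0; rewrite sb_act_lin !mul0r addr0.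
have h2 : 0 < e%:~R * form_at R P (flip sg (0, 1)).
  rewrite -E2; apply: (open_cell_outside _ _ _ _ _ _ _ cP).
    by rewrite mulNr oppr_le0 mulr_ge0.
  apply: contra_eq_neq E2 => ->; apply/eqP => e0.
  by apply: (sb_gen_neq0 0); left; move: e0; rewrite sb_act_lin !mul0r addr0.
have k1 : e%:~R * form_at R P (flip sg (1, 0)) = e%:~R * (coordS P + coordD P).
  by rewrite /flip /form_at /= mulr0; ring.
have k2 : e%:~R * form_at R P (flip sg (0, 1)) = e%:~R * (coordS P - coordD P).
  by rewrite /flip /form_at /= mulr1; case: ss => ->; rewrite ?mulrN1z ?mulr1z; ring.
rewrite k1 in h1; rewrite k2 in h2.
split=> //; have [_ _] := cP.
have [w1 w2] := sb_act_gt0 w (1, 1) ltr01 ltr01.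
move: w1 w2; case: (sb_act w (1, 1)) => x y /= x0 y0.
have -> : e%:~R * form_at R P (flip sg (x, y)) =
  (e%:~R * (coordS P + coordD P)) * x%:~R ^+ 2 +
  (e%:~R * (coordS P - coordD P)) * y%:~R ^+ 2 +
  2 * (e%:~R * sg%:~R * coordK P) * (x%:~R * y%:~R).
  by rewrite /form_at /= intrM; case: ss => ->; rewrite ?mulrN1z ?mulr1z; ring.
have xR : 0 < x%:~R :> R by rewrite ltr0z.
have yR : 0 < y%:~R :> R by rewrite ltr0z.
move=> neg; rewrite ltNge; apply/negP => k0; move: neg; apply/negP; rewrite -leNgt.
apply: addr_ge0; first apply: addr_ge0.
- exact: mulr_ge0 (ltW h1) (sqr_ge0 _).
- exact: mulr_ge0 (ltW h2) (sqr_ge0 _).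
- by apply: mulr_ge0; apply: mulr_ge0 => //; exact: ltW.
Qed.

(** In a quadrant one of the two inequalities of a rhombus is automatic or
    impossible; the other one is a condition on a vector of the tree. *)
Lemma quadrant_rhombus e sg (Delta : R) P x n : is_sign e -> is_sign sg ->
  quadrant R e sg P -> generation n x -> rhombus Delta x P ->
  exists2 v, sb_gen n v & e%:~R * form_at R P (flip sg v) < 0.
Proof.
move=> es ss qP gx /rhombusE[_ h1 h2].
have [tau [[p q] [ts gv xE]]] := generation_sb _ _ gx.
have [p0 q0] := sb_gen_ge0 _ _ gv; have gv' := sb_gen_swap _ _ gv.
have nz : (p, q) != (0, 0).
  by apply: contraPneq gv => ->; exact: sb_gen_neq0.
have nz' : (q, p) != (0, 0).
  by apply: contraPneq gv' => /= ->; exact: sb_gen_neq0.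
move: h1 h2; rewrite xE /= => h1 h2; rewrite /= in gv'.
have F u : is_sign tau -> form_at R P (- (tau * p), u) = form_at R P (p, - (tau * u)).
  by case=> ->; rewrite ?mulN1r ?mul1r ?opprK // -form_atN /= opprK.
rewrite (F _ ts) in h2.
have pos := form_at_quadrant _ e sg P (p, q) es ss qP p0 q0 nz.
have pos' := form_at_quadrant _ e sg P (q, p) es ss qP q0 p0 nz'.
rewrite /= in pos pos'.
case: es => es; subst e; rewrite ?mulrN1z ?mulr1z ?mul1r ?mulN1r in pos pos' *.
  exists (p, q) => //; rewrite mul1r /flip /=.
  suff -> : sg = - tau by rewrite mulNr.
  case: ss pos => ->; case: ts h2 => ->; rewrite ?mulN1r ?mul1r ?opprK // => h2 pos;
    by have := lt_trans h2 pos; rewrite ltxx.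
exists (q, p) => //; rewrite mulN1r oppr_lt0 /flip /=.
suff -> : sg = tau by [].
case: ss pos' => ->; case: ts h1 => ->; rewrite ?mulN1r ?mul1r ?opprK // => h1 pos';
  by move: h1 pos'; rewrite ?mul1r ?mulN1r ?opprK oppr_gt0 => h1 /(lt_trans h1); rewrite ltxx.
Qed.

(** Conversely, each vector of the tree comes from a rhombus. Which of the two
    inequalities it gives depends on [e]. *)
Lemma sb_rhombus e sg v n : is_sign e -> is_sign sg -> sb_gen n.+1 v ->
  exists2 x, generation n.+1 x & forall P,
    e%:~R * form_at R P (x.2, x.1) = e%:~R * form_at R P (v.2, - (sg * v.1)) /\
    e%:~R * form_at R P (- x.1, x.2) = e%:~R * form_at R P (flip sg v) /\ e = 1 \/
    e%:~R * form_at R P (x.2, x.1) = e%:~R * form_at R P (flip sg v) /\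
    e%:~R * form_at R P (- x.1, x.2) = e%:~R * form_at R P (v.2, - (sg * v.1)) /\
    e = -1.
Proof.
move=> es ss gv; have gv' := sb_gen_swap _ _ gv; case: es => ->.
  exists (- sg * v.1, v.2) => [|P].
    by apply: sb_generation gv; case: ss => ->; [right|left]; rewrite ?opprK.
  left; rewrite /flip /= mulNr opprK; split=> //; split=> //.
  by case: ss => ->; rewrite ?mul1r // !mulN1r -form_atN /= opprK.
exists (sg * v.2, v.1) => [|P]; first by apply: (sb_generation _ _ (v.2, v.1)).
right; rewrite /flip /=; split=> //; split=> //; congr (_ * _).
by case: ss => ->; rewrite ?mul1r ?mulN1r ?opprK // -form_atN /= opprK.
Qed.

End Rhombi.

(** * Topology of rhombi and cells *)

Lemma for_continuous_pair (T U V : topologicalType) (f : T -> U) (g : T -> V) x :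
  {for x, continuous f} -> {for x, continuous g} ->
  {for x, continuous (fun t => (f t, g t))}.
Proof. by move=> cf cg; apply: cvg_pair. Qed.

Section Topology.
Variable R : realType.
Implicit Types (P Q E : R * R * R) (v : int * int) (e sg : int) (Delta : R).

Definition affine_line P E (t : R) : R * R * R :=
  (coordK P + t * coordK E, coordD P + t * coordD E, coordS P + t * coordS E).

(** Radial projection to the hyperboloid; it preserves the signs of the form at
    all vectors. *)
Definition renorm Delta P : R * R * R :=
  let c := Num.sqrt (Delta / sdisc R P) in
  (c * coordK P, c * coordD P, c * coordS P).

Lemma form_at_renorm Delta P v :
  form_at R (renorm Delta P) v = Num.sqrt (Delta / sdisc R P) * form_at R P v.
Proof.
by rewrite /form_at /renorm /affine_line /coordK /coordD /coordS /=; ring.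
Qed.

Lemma form_at_affine_line P E t v :
  form_at R (affine_line P E t) v = form_at R P v + t * form_at R E v.
Proof.
by rewrite /form_at /renorm /affine_line /coordK /coordD /coordS /=; ring.
Qed.

Lemma renorm_factor_gt0 Delta P : 0 < Delta -> 0 < sdisc R P ->
  0 < Num.sqrt (Delta / sdisc R P).
Proof. by move=> D0 dP; rewrite sqrtr_gt0 divr_gt0. Qed.

Lemma hyperboloid_renorm Delta P : 0 < Delta -> 0 < sdisc R P ->
  hyperboloid Delta (renorm Delta P).
Proof.
move=> D0 dP; rewrite /hyperboloid /renorm /coordK /coordD /coordS /=.
rewrite !exprMn -mulrDr -mulrBr sqr_sqrtr ?divr_ge0 1?ltW //.
by rewrite -/(sdisc R P) divfK // gt_eqF.
Qed.

Lemma renorm_id Delta P : 0 < Delta -> hyperboloid Delta P -> renorm Delta P = P.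
Proof.
move=> D0; rewrite /hyperboloid /renorm /= /sdisc => ->.
by rewrite divff ?gt_eqF // sqrtr1 !mul1r; case: P => [[]].
Qed.

Lemma renorm_affine_line_continuous Delta P E t : 0 < sdisc R (affine_line P E t) ->
  {for t, continuous (fun t => renorm Delta (affine_line P E t))}.
Proof.
move=> d0.
have aff (a b : R) : (fun t => a + t * b) @ t --> a + t * b.
  by apply: cvgD; [exact: cvg_cst|apply: cvgM; [exact: cvg_id|exact: cvg_cst]].
have cd : (fun t => sdisc R (affine_line P E t)) @ t --> sdisc R (affine_line P E t).
  by rewrite /sdisc /=; apply: cvgB; [apply: cvgD|]; rewrite expr2;
    apply: cvgM; exact: aff.
have cc : (fun t => Num.sqrt (Delta / sdisc R (affine_line P E t))) @ t -->
  Num.sqrt (Delta / sdisc R (affine_line P E t)).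
  apply: (@continuous_cvg _ _ _ _ _ (fun t => Delta / sdisc R (affine_line P E t)) Num.sqrt).
    exact: sqrt_continuous.
  by apply: cvgM; [exact: cvg_cst|apply: cvgV => //; rewrite gt_eqF].
have cX (a b : R) : {for t, continuous (fun t =>
    Num.sqrt (Delta / sdisc R (affine_line P E t)) * (a + t * b))}.
  by apply: cvgM; [exact: cc|exact: aff].
rewrite /renorm; apply: for_continuous_pair; last exact: cX.
apply: for_continuous_pair; exact: cX.
Qed.

(** The weak inequalities become strict after adding a positive multiple of the
    axis of the rhombus, a form positive at (q,p) and negative at (-p,q); the
    projection brings the point back to H. *)
Lemma closure_rhombus Delta x P : 0 < Delta -> x != (0, 0) ->
  hyperboloid Delta P -> 0 <= form_at R P (x.2, x.1) ->
  form_at R P (- x.1, x.2) <= 0 -> closure (rhombus Delta x) P.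
Proof.
case: x => p q D0 nz hP /= h1 h2 B.
pose pR : R := p%:~R; pose qR : R := q%:~R.
pose N : R := pR ^+ 2 + qR ^+ 2.
have N0 : 0 < N.
  have [p0|p0] := eqVneq p 0.
    apply: ltr_wpDl; first exact: sqr_ge0.
    rewrite lt_neqAle sqr_ge0 andbT eq_sym sqrf_eq0 intr_eq0.
    by apply: contra nz => /eqP ->; rewrite p0.
  apply: ltr_pwDl; last exact: sqr_ge0.
  by rewrite lt_neqAle sqr_ge0 andbT eq_sym sqrf_eq0 intr_eq0.
(* Up to scale, the axis (0, 1, 0) of H^0, turned with the rhombus. *)
pose E : R * R * R := (2 * pR * qR, qR ^+ 2 - pR ^+ 2, 0).
have fE1 : form_at R E (q, p) = N ^+ 2.
  by rewrite /form_at /= /E /coordK /coordD /coordS /= -/pR -/qR /N; ring.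
have fE2 : form_at R E (- p, q) = - N ^+ 2.
  by rewrite /form_at /= /E /coordK /coordD /coordS /= intrN -/pR -/qR /N; ring.
have dE t : sdisc R (affine_line P E t) =
    Delta + t * (form_at R P (q, p) - form_at R P (- p, q)) + t ^+ 2 * N ^+ 2.
  rewrite -hP /sdisc /form_at /affine_line /E /N /= intrN -/pR -/qR /coordK /coordD /coordS /=.
  ring.
have d0 t : 0 <= t -> 0 < sdisc R (affine_line P E t).
  move=> t0; rewrite dE -addrA; apply: ltr_pwDl => //; apply: addr_ge0.
    by apply: mulr_ge0 => //; rewrite subr_ge0 (le_trans h2).
  by rewrite mulr_ge0 ?sqr_ge0.
have line0 : affine_line P E 0 = P.
  by rewrite /affine_line !mul0r !addr0; case: (P) => [[]].
have := renorm_affine_line_continuous Delta P E 0 (d0 0 (lexx 0)).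
move=> /(_ B); rewrite /= line0 renorm_id // => cB /cB [/= eps eps0 epsB].
exists (renorm Delta (affine_line P E (eps / 2))).
have t0 : 0 < eps / 2 by rewrite divr_gt0.
have dt := d0 _ (ltW t0); have c0 := renorm_factor_gt0 _ _ D0 dt.
split; last first.
  by apply: epsB; rewrite /= sub0r normrN gtr0_norm // ltr_pdivrMr //; lra.
apply/rhombusE; split; first exact: hyperboloid_renorm.
  rewrite form_at_renorm form_at_affine_line pmulr_rgt0 //= fE1.
  by apply: ltr_wpDl => //; rewrite mulr_gt0 // exprn_gt0.
rewrite form_at_renorm form_at_affine_line pmulr_rlt0 //= fE2.
by apply: ltr_wnDl => //; rewrite mulrN oppr_lt0 mulr_gt0 // exprn_gt0.
Qed.

(** The product of two values is the square of the polar form minus the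
    discriminant times the square of the determinant of the two vectors. *)
Lemma sdisc_indefinite P (u v : int * int) :
  form_at R P u * form_at R P v < 0 -> 0 < sdisc R P.
Proof.
pose B : R := (coordS P + coordD P) * u.1%:~R * v.1%:~R +
  (coordS P - coordD P) * u.2%:~R * v.2%:~R +
  coordK P * (u.1%:~R * v.2%:~R + u.2%:~R * v.1%:~R).
pose d : R := u.1%:~R * v.2%:~R - u.2%:~R * v.1%:~R.
have -> : form_at R P u * form_at R P v = B ^+ 2 - sdisc R P * d ^+ 2.
  by rewrite /form_at /sdisc /B /d; ring.
move=> neg; rewrite ltNge; apply/negP => s0; move: neg; rewrite ltNge => /negP; apply.
by rewrite addr_ge0 ?sqr_ge0 // -mulNr mulr_ge0 ?sqr_ge0 // oppr_ge0.
Qed.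

Definition cell Delta e sg w : set (R * R * R) :=
  hyperboloid Delta `&` open_cell R e sg w.

(** The inequalities of a cell define a convex cone of indefinite forms, so
    segments in it can be projected back to H. *)
Lemma cell_connected Delta e sg w : 0 < Delta -> is_sign e -> connected (cell Delta e sg w).
Proof.
move=> D0 es; have [->|/set0P[P [hP cP]]] := eqVneq (cell Delta e sg w) set0.
  exact: connected0.
(* The segment from P to Q, projected to the hyperboloid. *)
pose path Q (t : R) := renorm Delta (affine_line P (affine_line Q P (-1)) t).
have inC Q t : cell Delta e sg w Q -> t \in `[0, 1] ->
    0 < sdisc R (affine_line P (affine_line Q P (-1)) t) /\ cell Delta e sg w (path Q t).
  move=> [hQ [q1 q2 q3]]; rewrite in_itv /= => /andP[t0 t1].
  have [p1 p2 p3] := cP.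
  have F v : e%:~R * form_at R (affine_line P (affine_line Q P (-1)) t) v =
      (1 - t) * (e%:~R * form_at R P v) + t * (e%:~R * form_at R Q v).
    by rewrite !form_at_affine_line; ring.
  have conv (a b : R) : 0 < a -> 0 < b -> 0 < (1 - t) * a + t * b.
    move=> a0 b0; have [t0'|t0'] := ltrP 0 t.
      by apply: ltr_wpDl; [rewrite mulr_ge0 ?subr_ge0 // ltW|rewrite mulr_gt0].
    have -> : t = 0 by apply/le_anti; rewrite t0' t0.
    by rewrite subr0 mul1r mul0r addr0.
  have [l1 l2 l3] : open_cell R e sg w (affine_line P (affine_line Q P (-1)) t).
    split; rewrite F; try exact: conv.
    rewrite -oppr_gt0 opprD -[X in _ + X]mulrN -[X in X + _]mulrN.
    by apply: conv; rewrite oppr_gt0.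
  have d0 : 0 < sdisc R (affine_line P (affine_line Q P (-1)) t).
    apply: (sdisc_indefinite _ (flip sg (sb_act w (1, 0))) (flip sg (sb_act w (1, 1)))).
    by move: l1 l3; case: es => ->; rewrite ?mulrN1z ?mulr1z ?mul1r ?mulN1r => l1 l3;
      nra.
  split=> //; have c0 := renorm_factor_gt0 _ _ D0 d0.
  split; first exact: hyperboloid_renorm.
  by split; rewrite /path form_at_renorm mulrCA (pmulr_rgt0 _ c0, pmulr_rlt0 _ c0).
have -> : cell Delta e sg w =
    \bigcup_(Q in cell Delta e sg w) (path Q @` `[0, 1]).
  apply/seteqP; split=> [Q cQ|X [Q cQ [t t01 <-]]]; last by case: (inC Q t cQ t01).
  exists Q => //; exists 1; first by rewrite /= in_itv /= ler01 lexx.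
  have -> : path Q 1 = renorm Delta Q; last by rewrite renorm_id //; case: cQ.
  rewrite /path; congr renorm; case: (Q) (P) => [[? ?] ?] [[? ?] ?].
  by rewrite /affine_line /coordK /coordD /coordS /=; congr (_, _, _); ring.
apply: bigcup_connected => [|Q cQ].
  exists P => Q cQ; exists 0; first by rewrite /= in_itv /= ler01 lexx.
  have -> : path Q 0 = renorm Delta P; last by rewrite renorm_id.
  by rewrite /path /affine_line !mul0r !addr0; case: (P) => [[]].
apply: connected_continuous_connected; first exact: segment_connected.
apply: continuous_in_subspaceT => t; rewrite inE => t01.
by apply: renorm_affine_line_continuous; case: (inC Q t cQ t01).
Qed.

(** The image of [C] is an interval that avoids 0. *)
Lemma connected_sign (C : set (R * R * R)) (g : R * R * R -> R) P Q :
  connected C -> continuous g -> (forall X, C X -> g X != 0) ->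
  C P -> C Q -> 0 < g P -> 0 < g Q.
Proof.
move=> cC cg g0 CP CQ gP; rewrite ltNge; apply/negP => gQ.
have /connected_intervalP int : connected (g @` C).
  by apply: connected_continuous_connected => //; apply: continuous_subspaceT.
have [|||X CX gX] := int (g Q) (g P) _ _ 0.
- by exists Q.
- by exists P.
- by rewrite gQ ltW.
by move: (g0 _ CX); rewrite gX eqxx.
Qed.

Lemma KDS_continuous : [/\ continuous (@coordK R), continuous (@coordD R)
  & continuous (@coordS R)].
Proof.
split=> X.
- by apply: (@continuous_comp _ _ _ fst fst); exact: cvg_fst.
- by apply: (@continuous_comp _ _ _ fst snd); [exact: cvg_fst|exact: cvg_snd].
- exact: cvg_snd.
Qed.

Lemma form_at_continuous v : continuous (fun P => form_at R P v).
Proof.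
have [cK cD cS] := KDS_continuous => X.
apply: cvgD; [apply: cvgD|]; (repeat (apply: cvgM; last exact: cvg_cst)).
- by apply: cvgD; [exact: cS|exact: cD].
- by apply: cvgB; [exact: cS|exact: cD].
- by apply: cvgM; [exact: cvg_cst|exact: cK].
Qed.

Lemma open_cell_open e sg w : open (open_cell R e sg w).
Proof.
have c a v : continuous (fun P => a * form_at R P v).
  by move=> X; apply: cvgM; [exact: cvg_cst|exact: form_at_continuous].
have gt a v : open [set P | 0 < a * form_at R P v].
  by apply: (@open_comp _ _ (fun P => a * form_at R P v) [set x | x > 0]);
    [move=> X _; exact: c|exact: open_gt].
have lt a v : open [set P | a * form_at R P v < 0].
  by apply: (@open_comp _ _ (fun P => a * form_at R P v) [set x | x < 0]);
    [move=> X _; exact: c|exact: open_lt].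
rewrite (_ : open_cell R e sg w =
  [set P | 0 < e%:~R * form_at R P (flip sg (sb_act w (1, 0)))] `&`
  [set P | 0 < e%:~R * form_at R P (flip sg (sb_act w (0, 1)))] `&`
  [set P | e%:~R * form_at R P (flip sg (sb_act w (1, 1))) < 0]).
  by apply: openI; [apply: openI|].
by apply/seteqP; split=> X; [case|case=> [[]]].
Qed.

End Topology.

(** * Domains are cells *)

Section Domains.
Variable R : realType.
Implicit Types (P Q E : R * R * R) (v : int * int) (e sg : int).
Variable Delta : R.
Hypothesis D0 : 0 < Delta.

Lemma calH_hyperboloid n P : calH Delta n.+1 P -> hyperboloid Delta P.
Proof. by move=> [[x _ [hP _]] _]. Qed.

(** Removing the closures of the rhombi is what makes the values of the form at
    smaller generations nonzero, so that their signs are constant on a component. *)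
Lemma calH_not_closure n P i x : calH Delta n.+1 P -> (i <= n)%N ->
  generation i x -> x != (0, 0) ->
  ~ (0 <= form_at R P (x.2, x.1) /\ form_at R P (- x.1, x.2) <= 0).
Proof.
move=> cP i_n gx nz [h1 h2]; have hP := calH_hyperboloid _ _ cP.
have [_ nc] := cP; apply: nc; exists i => //; split=> //.
apply: (@closureS _ (rhombus Delta x)) (closure_rhombus _ _ _ _ D0 nz hP h1 h2).
by move=> Q xQ; exists x.
Qed.

(** Generation zero gives m n > 0, and then K^2 = Delta + 4 m n > 0. *)
Lemma calH_quadrant n P : calH Delta n.+1 P ->
  exists e sg, [/\ is_sign e, is_sign sg & quadrant R e sg P].
Proof.
move=> cP; have hP := calH_hyperboloid _ _ cP.
have n1 := calH_not_closure _ _ 0 (0, 1) cP isT (or_introl erefl) isT.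
have n2 := calH_not_closure _ _ 0 (1, 0) cP isT (or_intror erefl) isT.
have e1 : form_at R P (1, 0) = coordS P + coordD P by rewrite /form_at /=; ring.
have e2 : form_at R P (0, 1) = coordS P - coordD P by rewrite /form_at /=; ring.
have e3 : form_at R P (- 1, 0) = coordS P + coordD P.
  by rewrite -e1 -form_atN oppr0 opprK.
rewrite /= oppr0 e1 e2 e3 in n1 n2.
move: hP n1 n2; rewrite /hyperboloid /=.
set a := coordS P + coordD P; set b := coordS P - coordD P => hP n1 n2.
have [e [es ea eb]] : exists e, [/\ is_sign e, 0 < e%:~R * a & 0 < e%:~R * b].
  have [a0|a0] := ltrP 0 a.
    exists 1; rewrite mulr1z !mul1r; split=> //; first by left.
    by rewrite ltNge; apply/negP => b0; apply: n1; split=> //; apply: ltW.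
  exists (-1); rewrite mulrN1z !mulN1r !oppr_gt0; split=> //; first by right.
    rewrite lt_neqAle a0 andbT; apply/eqP => a00.
    have [b0|b0] := lerP b 0; first by apply: n1; rewrite a00.
    by apply: n2; rewrite a00; split=> //; apply: ltW.
  by rewrite ltNge; apply/negP => b0; apply: n2.
have ab : 0 < a * b.
  by move: ea eb; case: es => ->; rewrite ?mulrN1z ?mulr1z => ea eb; nra.
have K0 : coordK P != 0.
  apply/eqP => k0; have : Delta = - (a * b) by rewrite -hP k0 /a /b; ring.
  by move=> E; move: D0; rewrite E oppr_gt0 ltNge (ltW ab).
have eK : e%:~R * coordK P != 0.
  by rewrite mulf_neq0 //; case: es => ->; rewrite ?mulrN1z ?mulr1z ?oppr_eq0 oner_neq0.
have [k0|k0|k0] := ltrgtP (e%:~R * coordK P) 0.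
- by exists e, 1; split=> //; [left|split=> //; rewrite mulr1z mulr1].
- exists e, (-1); split=> //; [by right|split=> //].
  by rewrite mulrN1z mulrN1 mulNr oppr_lt0.
- by move: eK; rewrite k0 eqxx.
Qed.

Section Quadrant.
Variables e sg : int.
Hypotheses (es : is_sign e) (ss : is_sign sg).

Lemma form_at_quadrant0 P v : quadrant R e sg P -> sb_gen 0 v ->
  0 < e%:~R * form_at R P (flip sg v).
Proof.
move=> [h1 h2 _] [] -> ; rewrite /form_at /flip /=; move: h1 h2;
  case: ss => ->; rewrite ?mulr0 ?mul0r ?mulr1 ?mulrN1z ?mulr1z => h1 h2;
  by rewrite ?mulr0 ?expr0n /= ?expr1n ?sqrrN ?expr1n ?mulr0 ?mulr1 ?addr0 ?add0r ?mulr0z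
       ?mulr0 ?mulr1 ?addr0 ?add0r.
Qed.

Lemma calH_pos n P i v : calH Delta n.+1 P -> quadrant R e sg P ->
  (i <= n)%N -> sb_gen i v -> 0 < e%:~R * form_at R P (flip sg v).
Proof.
move=> cP qP i_n; case: i i_n => [|i] i_n gv; first exact: form_at_quadrant0.
rewrite ltNge; apply/negP => f0.
have [x gx xE] := sb_rhombus R e sg v i es ss gv.
have nz : x != (0, 0).
  have [tau [u [ts gu ->]]] := generation_sb _ _ gx.
  have [u1 u2] := sb_gen_gt0 _ _ gu.
  by rewrite xpair_eqE negb_and (gt_eqF u2) orbT.
have [v1 v2] := sb_gen_gt0 _ _ gv.
have pos := form_at_quadrant _ e sg P (v.2, v.1) es ss qP (ltW v2) (ltW v1).
have {}pos := pos _; rewrite /= xpair_eqE negb_and (gt_eqF v1) orbT in pos.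
have {}pos := pos isT.
apply: (calH_not_closure _ _ _ _ cP i_n gx nz).
by case: (xE P) => -[+ [+ e1]]; rewrite e1 ?mulrN1z ?mulr1z in pos f0 * => h1 h2;
    split; lra.
Qed.

Lemma calH_neg n P : calH Delta n.+1 P -> quadrant R e sg P ->
  exists2 w, size w = n & e%:~R * form_at R P (flip sg (sb_act w (1, 1))) < 0.
Proof.
move=> [[x gx xP] _] qP.
have [v [w sw <-] neg] := quadrant_rhombus _ _ _ _ _ _ _ es ss qP gx xP.
by exists w.
Qed.

Lemma calH_cell n P w : calH Delta n.+1 P -> quadrant R e sg P -> size w = n ->
  e%:~R * form_at R P (flip sg (sb_act w (1, 1))) < 0 -> cell R Delta e sg w P.
Proof.
move=> cP qP sw neg; split; first exact: calH_hyperboloid cP.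
split=> //.
  have [i + gi] := sb_gen_parent w (1, 0) (or_intror erefl).
  by rewrite sw => i_n; apply: calH_pos cP qP i_n gi.
have [i + gi] := sb_gen_parent w (0, 1) (or_introl erefl).
by rewrite sw => i_n; apply: calH_pos cP qP i_n gi.
Qed.

(** A cell is open and meets no rhombus of smaller generation, so it does not meet
    their closures either. *)
Lemma cell_sub_calH w : cell R Delta e sg w `<=` calH Delta (size w).+1.
Proof.
move=> P [hP cP]; have qP := open_cell_quadrant _ _ _ _ _ ss cP; split.
  have gw : sb_gen (size w).+1 (sb_act w (1, 1)) by exists w.
  have [x gx xE] := sb_rhombus R e sg _ _ es ss gw.
  exists x => //; apply/rhombusE.
  have [v1 v2] := sb_gen_gt0 _ _ gw.
  have pos := form_at_quadrant _ e sg P (_, _) es ss qP (ltW v2) (ltW v1).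
  rewrite /= xpair_eqE negb_and (gt_eqF v1) orbT in pos.
  have {}pos := pos isT; have [_ _ neg] := cP.
  by case: (xE P) => -[+ [+ e1]]; rewrite e1 ?mulrN1z ?mulr1z in pos neg * => h1 h2;
    split=> //; lra.
move=> [i /= i_w [clP _]].
have [Q [[x gx xQ] cQ]] := clP _ (open_nbhs_nbhs (conj (open_cell_open R e sg w) cP)).
have qQ := open_cell_quadrant _ _ _ _ _ ss cQ.
have [v gv neg] := quadrant_rhombus _ _ _ _ _ _ _ es ss qQ gx xQ.
by have [] := open_cell_gen _ _ _ _ _ _ _ cQ gv (ltW neg); lia.
Qed.

(** On a connected subset the signs of m, n, K and of the value at the vector of
    the cell are constant: that value cannot vanish, since each point of the
    subset lies in some cell of the same generation. *)
Lemma component_cell n P : calH Delta n.+1 P -> quadrant R e sg P ->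
  exists w, connected_component (calH Delta n.+1) P = cell R Delta e sg w.
Proof.
move=> cP qP; have [w sw neg] := calH_neg _ _ cP qP; exists w.
have cellP := calH_cell _ _ _ cP qP sw neg.
apply/seteqP; split; last first.
  apply: connected_component_max => //; first by rewrite -sw; exact: cell_sub_calH.
  exact: cell_connected.
move=> Q [C [CP CH cC] CQ].
have [cK cD cS] := KDS_continuous R.
have mulc (a : R) (g : R * R * R -> R) : continuous g -> continuous (fun X => a * g X).
  by move=> cg X; apply: cvgM; [exact: cvg_cst|exact: cg].
have enz : e%:~R != 0 :> R.
  by case: es => ->; rewrite ?mulrN1z ?mulr1z ?oppr_eq0 oner_neq0.
have senz : sg%:~R != 0 :> R.
  by case: ss => ->; rewrite ?mulrN1z ?mulr1z ?oppr_eq0 oner_neq0.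
have nz X : C X -> [/\ coordS X + coordD X != 0, coordS X - coordD X != 0 & coordK X != 0].
  move=> /CH /calH_quadrant[e' [sg' [_ _ [h1 h2 h3]]]].
  by split; apply/eqP => e0; move: h1 h2 h3; rewrite e0 !mulr0 ltxx.
have qC X : C X -> quadrant R e sg X.
  move=> CX; have [q1 q2 q3] := qP; split.
  - apply: (connected_sign _ C (fun X => e%:~R * (coordS X + coordD X)) P) => // [|Y CY].
    + by apply: mulc => Y; apply: cvgD; [exact: cS|exact: cD].
    + by rewrite mulf_neq0 //; case: (nz Y CY).
  - apply: (connected_sign _ C (fun X => e%:~R * (coordS X - coordD X)) P) => // [|Y CY].
    + by apply: mulc => Y; apply: cvgB; [exact: cS|exact: cD].
    + by rewrite mulf_neq0 //; case: (nz Y CY).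
  - rewrite -oppr_gt0 -mulNr.
    apply: (connected_sign _ C (fun X => - (e%:~R * sg%:~R) * coordK X) P) => // [|Y CY|].
    + exact: mulc.
    + by rewrite mulf_neq0 ?oppr_eq0 ?mulf_neq0 //; case: (nz Y CY).
    + by rewrite mulNr oppr_gt0.
have fnz X : C X -> e%:~R * form_at R X (flip sg (sb_act w (1, 1))) != 0.
  move=> CX; apply/eqP => f0.
  have [w' sw' neg'] := calH_neg _ _ (CH _ CX) (qC _ CX).
  have [_ cX'] := calH_cell _ _ _ (CH _ CX) (qC _ CX) sw' neg'.
  have gw : sb_gen (size w).+1 (sb_act w (1, 1)) by exists w.
  have [|_ ww'] := open_cell_gen _ _ _ _ _ _ _ cX' gw; first by rewrite f0.
  by move: neg'; rewrite -ww' ?sw ?sw' // f0 ltxx.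
apply: (calH_cell _ _ _ (CH _ CQ) (qC _ CQ) sw); rewrite -oppr_gt0 -mulNr.
apply: (connected_sign _ C (fun X => - e%:~R * form_at R X (flip sg (sb_act w (1, 1)))) P) => //.
- exact/mulc/form_at_continuous.
- by move=> X CX; rewrite mulNr oppr_eq0 fnz.
- by rewrite mulNr oppr_gt0.
Qed.

(** The existence part exhibits the point m = n = e in a cell of generation one. *)
Lemma quadrant_domain (G : set (R * R * R)) :
  (forall P, G P <-> hyperboloid Delta P /\ quadrant R e sg P) ->
  (forall D, domain_in Delta G D -> exists w, D = cell R Delta e sg w) /\
  exists D, domain_in Delta G D.
Proof.
move=> GE; split=> [D [DG [[//|n] _ [P cP DE]]]|].
  have DP : D P by rewrite DE; exact: connected_component_refl.
  by have /GE[_ /(component_cell _ _ cP)] := DG _ DP; rewrite DE.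
(* The form e (x^2 + y^2) - e sg k x y, of discriminant Delta. *)
pose k : R := Num.sqrt (Delta + 4).
have k0 : 0 <= k := sqrtr_ge0 _.
have kk : k ^+ 2 = Delta + 4 by rewrite sqr_sqrtr // addr_ge0 // ltW.
have k2 : 2 < k.
  rewrite ltNge; apply/negP => k2; have : k ^+ 2 <= 2 ^+ 2 by rewrite lerXn2r ?nnegrE.
  by rewrite kk expr2; move: D0; lra.
pose P : R * R * R := (- (e * sg)%:~R * k, 0, 2 * e%:~R).
have cP : cell R Delta e sg [::] P.
  split.
    rewrite /hyperboloid /P /coordK /coordD /coordS /= intrM.
    case: es => ->; case: ss => ->; rewrite ?mulrN1z ?mulr1z exprMn kk; ring.
  split; rewrite /form_at /P /coordK /coordD /coordS /= !intrM;
    case: es => ->; case: ss => ->; rewrite ?mulrN1z ?mulr1z ?mulr0z; lra.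
have hP := cell_sub_calH _ _ cP.
have [w wE] := component_cell _ _ hP (open_cell_quadrant _ _ _ _ _ ss cP.2).
exists (cell R Delta e sg w); split.
  by move=> Q [hQ cQ]; apply/GE; split=> //; apply: open_cell_quadrant cQ.
by exists 1%N => //; exists P.
Qed.

End Quadrant.
End Domains.

(** * The theorem *)

Lemma sgn_form_gt0 (R : realType) (e z : int) :
  (0 < e%:~R * (2 * z%:~R) :> R) = (0 < e * z).
Proof. by rewrite mulrCA pmulr_rgt0 // -intrM ltr0z. Qed.

Lemma sgn_form_lt0 (R : realType) (e z : int) :
  (e%:~R * (2 * z%:~R) < 0 :> R) = (e * z < 0).
Proof. by rewrite mulrCA pmulr_rlt0 // -intrM ltrz0. Qed.

Lemma hyperboloid_KDS (R : realType) (rho : nat) h :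
  hyperboloid (rho%:R ^+ 2) (KDS R h) <-> disc h = (rho : int) ^+ 2.
Proof.
case: h => [[m n] k]; rewrite /hyperboloid /KDS /coordK /coordD /coordS /=.
have -> : k%:~R ^+ 2 + (m - n)%:~R ^+ 2 - (m + n)%:~R ^+ 2 =
  (k ^+ 2 - 4 * m * n)%:~R :> R.
  by rewrite !expr2 !(intrD, intrN, intrM); ring.
have -> : rho%:R ^+ 2 = ((rho : int) ^+ 2)%:~R :> R by rewrite !expr2 intrM pmulrn.
by split=> [/intr_inj|->].
Qed.

Lemma cell_reduced (R : realType) (Delta : R) e sg w : is_sign sg ->
  exists a b c d : int, a * d - b * c = 1 /\ forall h,
    open_cell R e sg w (KDS R h) <-> reduced e (form_subst a b c d h).
Proof.
move=> ss; have det1 := sb_act_det w.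
have E11 := sb_act_lin w 1 1.
rewrite /open_cell E11; move: det1.
case: (sb_act w (1, 0)) => a1 a2; case: (sb_act w (0, 1)) => b1 b2 /= det1.
case: ss => ->.
  exists a1, b1, a2, b2; split=> // h.
  rewrite /flip /= !form_at_KDS sgn_form_gt0 sgn_form_gt0 sgn_form_lt0 !mul1r.
  case: h => [[m n] k] /=.
  have -> : m * a1 ^+ 2 + n * a2 ^+ 2 + k * a1 * a2 +
      (m * b1 ^+ 2 + n * b2 ^+ 2 + k * b1 * b2) +
      (2 * m * a1 * b1 + 2 * n * a2 * b2 + k * (a1 * b2 + b1 * a2)) =
      m * (a1 + b1) ^+ 2 + n * (a2 + b2) ^+ 2 + k * (a1 + b1) * (a2 + b2) by ring.
  by split=> [[h1 h2 h3]|/and3P[h1 h2 h3]]; [apply/and3P|]; split.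
(* The reflected columns in the other order have determinant 1 again. *)
exists b1, a1, (- b2), (- a2); split=> [|h]; first by rewrite -[RHS]det1; ring.
rewrite /flip /= !form_at_KDS sgn_form_gt0 sgn_form_gt0 sgn_form_lt0 !mul1r !mulN1r.
case: h => [[m n] k] /=.
have -> : m * b1 ^+ 2 + n * (- b2) ^+ 2 + k * b1 * - b2 +
    (m * a1 ^+ 2 + n * (- a2) ^+ 2 + k * a1 * - a2) +
    (2 * m * b1 * a1 + 2 * n * - b2 * - a2 + k * (b1 * - a2 + a1 * - b2)) =
    m * (a1 + b1) ^+ 2 + n * (- (a2 + b2)) ^+ 2 + k * (a1 + b1) * - (a2 + b2) by ring.
by split=> [[h1 h2 h3]|/and3P[h1 h2 h3]]; [apply/and3P|]; split.
Qed.

Lemma card_cell (R : realType) (Delta : R) f e sg w n : is_sign sg ->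
  (forall h, orbit_of f h -> hyperboloid Delta (KDS R h)) ->
  ([set h | orbit_of f h /\ reduced e h] #= `I_n)%card ->
  ([set h | orbit_of f h /\ cell R Delta e sg w (KDS R h)] #= `I_n)%card.
Proof.
move=> ss hyp card_n; have [a [b [c [d [det1 cE]]]]] := cell_reduced R Delta e sg w ss.
have := card_reduced_subst f e a b c d n det1 card_n.
rewrite (_ : [set h | _ /\ reduced _ _] =
  [set h | orbit_of f h /\ cell R Delta e sg w (KDS R h)]) //.
apply/seteqP; split=> h [oh]; first by move=> /cE; split=> //; split=> //; exact: hyp.
by move=> [_ /cE].
Qed.

(** Domains exist, so the number of points in them is determined. *)
Lemma orbit_countP (R : realType) (Delta : R) (G : set (R * R * R)) f e sg n m :
  0 < Delta -> is_sign e -> is_sign sg ->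
  (forall P, G P <-> hyperboloid Delta P /\ quadrant R e sg P) ->
  (forall h, orbit_of f h -> hyperboloid Delta (KDS R h)) ->
  ([set h | orbit_of f h /\ reduced e h] #= `I_n)%card ->
  orbit_count_in_domains Delta f G m <-> m = n.
Proof.
move=> D0 es ss GE hyp card_n.
have [dom [D DG]] := quadrant_domain R Delta D0 e sg es ss G GE.
split=> [/(_ D DG) card_m|-> {D DG} D /dom[w ->]]; last exact: card_cell.
have [w DE] := dom D DG; rewrite DE in card_m.
apply/card_eq_II; apply: card_eq_trans (card_cell _ _ _ _ _ w _ ss hyp card_n).
by rewrite card_eq_sym.
Qed.

Section Quadrants.
Variables (R : realType) (Delta : R).

Lemma GA_quadrant P : GA Delta P <-> hyperboloid Delta P /\ quadrant R 1 (-1) P.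
Proof.
rewrite /GA /quadrant /= ltr_norml mulr1z mulrN1z.
split=> [[hP [/andP[h1 h2] h3]]|[hP [h1 h2 h3]]]; split=> //.
  by split; lra.
by split; [apply/andP; split|]; lra.
Qed.

Lemma GAbar_quadrant P : GAbar Delta P <-> hyperboloid Delta P /\ quadrant R 1 1 P.
Proof.
rewrite /GAbar /quadrant /= ltr_norml mulr1z.
split=> [[hP [/andP[h1 h2] h3]]|[hP [h1 h2 h3]]]; split=> //.
  by split; lra.
by split; [apply/andP; split|]; lra.
Qed.

Lemma GB_quadrant P : GB Delta P <-> hyperboloid Delta P /\ quadrant R (-1) (-1) P.
Proof.
rewrite /GB /quadrant /= ltrNr ltr_norml mulrN1z.
split=> [[hP [/andP[h1 h2] h3]]|[hP [h1 h2 h3]]]; split=> //.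
  by split; lra.
by split; [apply/andP; split|]; lra.
Qed.

Lemma GBbar_quadrant P : GBbar Delta P <-> hyperboloid Delta P /\ quadrant R (-1) 1 P.
Proof.
rewrite /GBbar /quadrant /= ltrNr ltr_norml mulrN1z mulr1z.
split=> [[hP [/andP[h1 h2] h3]]|[hP [h1 h2 h3]]]; split=> //.
  by split; lra.
by split; [apply/andP; split|]; lra.
Qed.

Lemma H0_KDS (rho : nat) h : H0 (rho%:R ^+ 2 : R) (KDS R h) ->
  inH0 h /\ disc h = (rho : int) ^+ 2.
Proof.
move=> [/hyperboloid_KDS dh [lt D0]]; split=> //; move: lt D0.
case: h {dh} => [[m n] k]; rewrite /KDS /coordS /coordD /= => lt.
rewrite ltr0z => mn; rewrite -!intr_norm ltr_int in lt.
by lia.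
Qed.
End Quadrants.

Theorem theorem4p19 (R : realType) (rho : nat) (hrho : (0 < rho)%N)
    (f g : good_point) (s : seq good_point) (t : nat)
    (hchain : is_chain (rho%:R : R) f s)
    (ht : t = size (f :: s)) (hg : g = last f s)
    (T : good_point -> good_point) (hT : calTplus T) (hTfg : T f = g) :
  let Delta : R := rho%:R ^+ 2 in
  (exists w : seq generator, size w = (t - 1)%N /\ T = gen_prod w) /\
  (forall w : seq generator, size w = (t - 1)%N -> T = gen_prod w ->
     forall tA tB : nat,
       (count is_A w = tA /\ count is_B w = tB <->
        [/\ orbit_count_in_domains Delta f (GA Delta) tB,
            orbit_count_in_domains Delta f (GAbar Delta) tB,
            orbit_count_in_domains Delta f (GB Delta) tA &
            orbit_count_in_domains Delta f (GBbar Delta) tA]) /\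
       (count is_A w = tA /\ count is_B w = tB -> (tA + tB = t - 1)%N)).
Proof.
move=> Delta; have [inH pth [hFA _] [hFl _]] := hchain.
have aH : all inH0 (f :: s) by apply/allP => h /inH /H0_KDS[].
have [_ df] := H0_KDS _ _ _ (inH f (mem_head f s)).
have v0 : val_diff f = 0.
  move: hFA => [r _]; case: (f) => [[m n] k] /= [_ e1 e2].
  by apply/eqP; rewrite -(intr_eq0 R); apply/eqP; move: e1 e2;
     rewrite !(intrD, intrN); lra.
have u0 : val_sum (last f s) = 0.
  move: hFl => [r _]; case: (last f s) => [[m n] k] /= [_ e1 e2].
  by apply/eqP; rewrite -(intr_eq0 R); apply/eqP; move: e1 e2;
     rewrite !(intrD, intrN); lra.
have t1 : (t - 1 = size s)%N by rewrite ht /= subn1.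
have word w : T = gen_prod w ->
  [/\ size w = size s, count is_A w = count (fun h => val_diff h < 0) s &
      count is_B w = count (fun h => 0 < val_diff h) s].
  by move=> Tw; apply: chain_word aH pth u0 _; rewrite -Tw hTfg.
split; first by have [w Tw] := calTplus_word T hT; exists w; case: (word w Tw) => ->.
move=> w sw Tw tA tB; have [_ eA eB] := word w Tw.
have rho0 : 0 < (rho : int) by [].
have D0 : 0 < Delta by rewrite exprn_gt0 // ltr0n.
have hyp h : orbit_of f h -> hyperboloid Delta (KDS R h).
  by move=> oh; apply/hyperboloid_KDS; rewrite (orbit_disc f h oh).
have cpos := card_reduced_pos (rho : int) f s rho0 aH pth u0 v0 df.
have cneg := card_reduced_neg (rho : int) f s rho0 aH pth u0 v0 df.
have p1 : is_sign 1 by left.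
have m1 : is_sign (-1) by right.
have cA := orbit_countP R Delta _ f _ _ _ tB D0 p1 m1 (GA_quadrant R Delta) hyp cpos.
have cA' := orbit_countP R Delta _ f _ _ _ tB D0 p1 p1 (GAbar_quadrant R Delta) hyp cpos.
have cB := orbit_countP R Delta _ f _ _ _ tA D0 m1 m1 (GB_quadrant R Delta) hyp cneg.
have cB' := orbit_countP R Delta _ f _ _ _ tA D0 m1 p1 (GBbar_quadrant R Delta) hyp cneg.
split; last first.
  move=> [<- <-]; rewrite -sw; elim: (w) => //= x w' <-; case: x => /=; lia.
rewrite eA eB; split=> [[nA nB]|[/cA -> _ /cB -> _]] //.
by split; [apply/cA|apply/cA'|apply/cB|apply/cB'].
Qed.
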